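(* Let $ML^n_p=(J^1(T,M),L)$ be a metrical multi-time Lagrange space with respect to the semi-Riemannian metric $h$ on $T$. Its electromagnetic components $F^{(\alpha)}_{(i)j}$ are governed by the following Maxwell equations: (i) for $p=\dim T=1$, $$F^{(1)}_{(i)k/1}=\frac12\mathcal A_{\{i,k\}}\left\{\bar D^{(1)}_{(i)1\vert k}+D^{(1)}_{(i)m}T^m_{1k}+d^{(1)(1)}_{(i)(m)}R^{(m)}_{(1)1k}-\left[T^r_{1i\vert k}+C^{r(1)}_{k(m)}R^{(m)}_{(1)1i}\right]y_{(r)}\right\},$$ $$\sum_{\{i,j,k\}}F^{(1)}_{(i)j\vert k}=-\frac12\sum_{\{i,j,k\}}C^{(1)(1)(1)}_{(i)(l)(m)}R^{(m)}_{(1)jk}y^l,\qquad \sum_{\{i,j,k\}}F^{(1)}_{(i)j}\vert^{(1)}_{(k)}=0,$$ where $y_{(r)}=G^{(1)(1)}_{(r)(q)}y^q$ and $C^{(1)(1)(1)}_{(i)(l)(m)}=G^{(1)(1)}_{(l)(q)}C^{q(1)}_{i(m)}=\frac{h^{11}}2\frac{\partial^3L}{\partial y^i\partial y^l\partial y^m}$; (ii) for $p\ge2$, $$F^{(\alpha)}_{(i)k/\beta}=\frac12\mathcal A_{\{i,k\}}\left\{\bar D^{(\alpha)}_{(i)\beta\vert k}+D^{(\alpha)}_{(i)m}T^m_{\beta k}+d^{(\alpha)(\mu)}_{(i)(m)}R^{(m)}_{(\mu)\beta k}-\left[T^r_{\beta i\vert k}+C^{r(\mu)}_{k(m)}R^{(m)}_{(\mu)\beta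 i}\right]x^{(\alpha)}_{(r)}\right\},$$ $$\sum_{\{i,j,k\}}F^{(\alpha)}_{(i)j\vert k}=0,\qquad\sum_{\{i,j,k\}}F^{(\alpha)}_{(i)j}\vert^{(\gamma)}_{(k)}=0,$$ where $x^{(\alpha)}_{(r)}=G^{(\alpha)(\beta)}_{(r)(q)}x^q_\beta$.
   Context: **Space.** $T$ (dimension $p$, coordinates $t^\alpha$) and $M$ (dimension $n$, coordinates $x^i$) are smooth real manifolds; $E=J^1(T,M)\to T\times M$ is the first-order jet bundle with induced coordinates $(t^\alpha,x^i,x^i_\alpha)$. Greek indices run over $1,\dots,p$, Latin over $1,\dots,n$; repeated indices are summed. If $p=1$ write $t=t^1$, $y^i=x^i_1$. $h=(h_{\alpha\beta}(t))$ is a fixed semi-Riemannian metric on $T$ with inverse $(h^{\alpha\beta})$ and Christoffel symbols $H^\gamma_{\alpha\beta}=\frac{h^{\gamma\eta}}2\left(\frac{\partial h_{\eta\alpha}}{\partial t^\beta}+\frac{\partial h_{\eta\beta}}{\partial t^\alpha}-\frac{\partial h_{\alpha\beta}}{\partial t^\eta}\right)$. A metrical multi-time Lagrange space $ML^n_p=(J^1(T,M),L)$ is given by a smooth $L:E\to\mathbb R$ that is Kronecker $h$-regular: $G^{(\alpha)(\beta)}_{(i)(j)}:=\frac12\frac{\partial^2L}{\partial x^i_\alpha\partial x^j_\beta}=h^{\alpha\beta}g_{ij}$, with $g_{ij}$ a symmetric d-tensor (distinguished tensor) on $E$ of rank $n$ and constant signature, with inverse $g^{ij}$. For $p\ge2$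 it is known that then $g_{ij}=g_{ij}(t,x)$ and $L=h^{\alpha\beta}(t)g_{ij}(t,x)x^i_\alpha x^j_\beta+U^{(\alpha)}_{(i)}(t,x)x^i_\alpha+F(t,x)$; put $U^{(\beta)}_{(k)j}=\frac{\partial U^{(\beta)}_{(k)}}{\partial x^j}-\frac{\partial U^{(\beta)}_{(j)}}{\partial x^k}$. **Canonical nonlinear connection** $\Gamma=(M^{(i)}_{(\alpha)\beta},N^{(i)}_{(\alpha)j})$: $M^{(i)}_{(\alpha)\beta}=-H^\gamma_{\alpha\beta}x^i_\gamma$. For $p=1$: $N^{(i)}_{(1)j}=h_{11}\frac{\partial\mathcal G^i}{\partial y^j}$ with $\mathcal G^i=\frac{g^{ik}}4\left(\frac{\partial^2L}{\partial x^j\partial y^k}y^j-\frac{\partial L}{\partial x^k}+\frac{\partial^2L}{\partial t\partial y^k}+\frac{\partial L}{\partial y^k}H^1_{11}+2h^{11}H^1_{11}g_{kl}y^l\right)$. For $p\ge2$: $N^{(i)}_{(\alpha)j}=\Gamma^i_{jk}x^k_\alpha+\frac{g^{ik}}2\frac{\partial g_{jk}}{\partial t^\alpha}+\frac{g^{ik}}4h_{\alpha\beta}U^{(\beta)}_{(k)j}$, with $\Gamma^i_{jk}=\frac{g^{im}}2\left(\frac{\partial g_{mj}}{\partial x^k}+\frac{\partial g_{mk}}{\partial x^j}-\frac{\partial g_{jk}}{\partial x^m}\right)$. Adapted derivatives: $\frac{\delta}{\delta t^\alpha}=\frac{\partial}{\partial t^\alpha}-M^{(j)}_{(\beta)\alpha}\frac{\partial}{\partial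 x^j_\beta}$, $\frac{\delta}{\delta x^i}=\frac{\partial}{\partial x^i}-N^{(j)}_{(\beta)i}\frac{\partial}{\partial x^j_\beta}$. **Cartan canonical connection** $C\Gamma=(H^\gamma_{\alpha\beta},G^k_{j\gamma},L^i_{jk},C^{i(\gamma)}_{j(k)})$: $G^k_{j\gamma}=\frac{g^{ki}}2\frac{\delta g_{ij}}{\delta t^\gamma}$, $L^i_{jk}=\frac{g^{im}}2\left(\frac{\delta g_{mj}}{\delta x^k}+\frac{\delta g_{mk}}{\delta x^j}-\frac{\delta g_{jk}}{\delta x^m}\right)$, $C^{i(\gamma)}_{j(k)}=\frac{g^{im}}2\left(\frac{\partial g_{mj}}{\partial x^k_\gamma}+\frac{\partial g_{mk}}{\partial x^j_\gamma}-\frac{\partial g_{jk}}{\partial x^m_\gamma}\right)$ (so $C^{i(\gamma)}_{j(k)}=0$ and $L^i_{jk}=\Gamma^i_{jk}$ when $p\ge2$). Its covariant derivatives of d-tensors are: ${}_{/\gamma}$, given by $\frac{\delta}{\delta t^\gamma}$ plus, for each upper (lower) spatial index, the usual correction with $+G^i_{m\gamma}$ ($-G^m_{i\gamma}$) and, for each upper (lower) temporal index, the correction with $+H^\alpha_{\mu\gamma}$ ($-H^\mu_{\alpha\gamma}$); ${}_{\vert k}$, given by $\frac{\delta}{\delta x^k}$ plus corrections with $+L^i_{mk}$ ($-L^m_{ik}$) on spatial indices only; $\vert^{(\gamma)}_{(k)}$, given by $\frac{\partial}{\partial x^k_\gamma}$ plus corrections with $+C^{i(\gamma)}_{m(k)}$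 ($-C^{m(\gamma)}_{i(k)}$) on spatial indices only. A paired index ${}^{(i)}_{(\alpha)}$ or ${}^{(\alpha)}_{(i)}$ counts as one spatial and one temporal index. **Torsion components used.** $T^m_{\alpha j}=-G^m_{j\alpha}$ for all $p$. For $p=1$: $R^{(m)}_{(1)1j}=-\frac{\partial N^{(m)}_{(1)j}}{\partial t}+H^1_{11}\left[N^{(m)}_{(1)j}-\frac{\partial N^{(m)}_{(1)j}}{\partial y^k}y^k\right]$ and $R^{(m)}_{(1)ij}=\frac{\delta N^{(m)}_{(1)i}}{\delta x^j}-\frac{\delta N^{(m)}_{(1)j}}{\delta x^i}$. For $p\ge2$: $R^{(m)}_{(\mu)\alpha j}=-\frac{\partial N^{(m)}_{(\mu)j}}{\partial t^\alpha}+\frac{g^{mk}}2H^\beta_{\mu\alpha}\left[\frac{\partial g_{jk}}{\partial t^\beta}+\frac{h_{\beta\gamma}}2U^{(\gamma)}_{(k)j}\right]$. **Deflection and electromagnetic d-tensors.** With $x^{(\alpha)}_{(i)}=G^{(\alpha)(\gamma)}_{(i)(k)}x^k_\gamma$: $\bar D^{(\alpha)}_{(i)\beta}=x^{(\alpha)}_{(i)/\beta}$, $D^{(\alpha)}_{(i)j}=x^{(\alpha)}_{(i)\vert j}$, $d^{(\alpha)(\beta)}_{(i)(j)}=x^{(\alpha)}_{(i)}\vert^{(\beta)}_{(j)}$, and $F^{(\alpha)}_{(i)j}=\frac12\left[D^{(\alpha)}_{(i)j}-D^{(\alpha)}_{(j)i}\right]$. **Sums.** $\mathcal A_{\{i,k\}}\{E_{ik}\}=E_{ik}-E_{ki}$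 (alternate sum); $\sum_{\{i,j,k\}}$ is the cyclic sum over $i,j,k$.
   Formalization: In (i) the two printed expressions for C_(i)(l)(m) disagree (n=1, h=1, L=e^y: e^y/4 vs e^y/2). The formal C_(i)(l)(m) is (1/2)∂³L/∂y^i∂y^l∂y^m, without the factor h^11, and G_(l)(q)C^q_i(m) is proved equal to half of it. *)

(* Defs.v *)
From HB Require Import structures.
From mathcomp Require Import all_boot all_order all_algebra.
From mathcomp Require Import all_classical all_reals all_analysis.

Set Implicit Arguments.
Unset Strict Implicit.
Unset Printing Implicit Defensive.

Import Order.TTheory GRing.Theory Num.Theory.
Import numFieldNormedType.Exports.

Local Open Scope classical_set_scope.
Local Open Scope ring_scope.

(** * Smooth maps, smooth manifolds, semi-Riemannian metrics *)

Section Smooth.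
Context {R : realType} {V W : normedModType R}.

Definition iter_derive (vs : seq V) (f : V -> W) : V -> W :=
  foldr (fun v g => fun x => 'D_v g x) f vs.

(* Meant for open A and finite-dimensional V, where existence and continuity of
   all iterated directional derivatives is the usual C^oo condition. *)
Definition smooth_on (A : set V) (f : V -> W) : Prop :=
  forall (vs : seq V) (x : V), A x ->
    {for x, continuous (iter_derive vs f)} /\
    forall v, derivable (iter_derive vs f) x v.

End Smooth.

(* S is congruent to diag(1, .., 1, -1, .., -1) with q ones. *)
Definition has_signature (R : realType) (n q : nat) (S : 'M[R]_n) : Prop :=
  exists2 P : 'M[R]_n, P \in unitmx &
    P *m S *m P^T =
    \matrix_(i, j) (if i == j then (if (i < q)%N then 1 else -1) else 0).

(* [coord] is only meaningful on [dom], and [param], the inverse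
   parametrization, only on [coord @` dom]. *)
Record chart (R : realType) (n : nat) (X : topologicalType) := Chart {
  dom : set X;
  coord :> X -> 'rV[R]_n;
  param : 'rV[R]_n -> X;
  dom_open : open dom;
  img_open : open (coord @` dom);
  coordK : forall x, dom x -> param (coord x) = x;
  coord_cts : {within dom, continuous coord};
  param_cts : {within coord @` dom, continuous param}
}.

Definition img (R : realType) n X (c : chart R n X) : set 'rV[R]_n :=
  coord c @` dom c.

Record manifold (R : realType) (n : nat) := Manifold {
  space :> topologicalType;
  atlas : set (chart R n space);
  manifold_hausdorff : hausdorff_space space;
  manifold_countable : @second_countable space;
  atlas_cover : forall x : space, exists2 c, atlas c & dom c x;
  atlas_smooth : forall c c', atlas c -> atlas c' ->
    smooth_on (coord c @` (dom c `&` dom c')) (coord c' \o param c)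
}.

(* Jacobian at x of the change of coordinates from c to c'; with the row-vector
   convention its (a, b) entry is the derivative of the b-th new coordinate with
   respect to the a-th old one. *)
Definition transition_jac (R : realType) n (X : topologicalType)
    (c c' : chart R n X) (x : X) : 'M[R]_n :=
  'J (coord c' \o param c) (coord c x).

Record metric (R : realType) (p : nat) (T : manifold R p) := Metric {
  metric_comp :> chart R p T -> T -> 'M[R]_p;
  metric_tensor : forall c c' t, atlas c -> atlas c' -> dom c t -> dom c' t ->
    metric_comp c t =
    transition_jac c c' t *m metric_comp c' t *m (transition_jac c c' t)^T;
  metric_smooth : forall c, atlas c -> forall a b,
    smooth_on (img c) (fun s => metric_comp c (param c s) a b);
  metric_sym : forall c t, atlas c -> dom c t ->
    (metric_comp c t)^T = metric_comp c t;
  metric_nondeg : forall c t, atlas c -> dom c t ->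
    metric_comp c t \in unitmx;
  metric_sign : exists q, forall c t, atlas c -> dom c t ->
    has_signature q (metric_comp c t)
}.

(** * The first-order jet bundle *)

Section Jets.
Context {R : realType} {p n : nat} {T : manifold R p} {M : manifold R n}.

Definition smooth_near (t : T) (f : T -> M) : Prop :=
  exists2 U : set T, open_nbhs t U &
    (forall s, U s -> {for s, continuous f}) /\
    forall c d, atlas c -> atlas d ->
      smooth_on (coord c @` (U `&` dom c `&` f @^-1` dom d))
                (coord d \o f \o param c).

Definition same_jet (t : T) (f f' : T -> M) : Prop :=
  f t = f' t /\
  forall c d, atlas c -> atlas d -> dom c t -> dom d (f t) ->
    'J (coord d \o f \o param c) (coord c t) =
    'J (coord d \o f' \o param c) (coord c t).

(* A 1-jet is a source point together with an equivalence class of local maps.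
   J^1(T, M) consists of the [jet t f] with [smooth_near t f]; a function on it is
   represented by a function on the ambient type [T * set (T -> M)], whose values
   elsewhere play no role. *)
Definition jet (t : T) (f : T -> M) : T * set (T -> M) :=
  (t, [set f' | smooth_near t f' /\ same_jet t f f']).

End Jets.

(* Values of the induced coordinates: in z = (t, x, v) the entry v a i is
   x^i_a. *)
Notation coords R p n := ('rV[R]_p * 'rV[R]_n * 'M[R]_(p, n))%type.

Section InducedCharts.
Context {R : realType} {p n : nat} {T : manifold R p} {M : manifold R n}.
Variables (c : chart R p T) (d : chart R n M).

Definition jet_dom : set (coords R p n) :=
  [set z | img c z.1.1 /\ img d z.1.2].

(* The jet with coordinates (t, x, v), represented by the map whose coordinate
   expression is the affine map s |-> x + (s - t) v. *)
Definition jet_of (z : coords R p n) : T * set (T -> M) :=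
  jet (param c z.1.1)
      (fun s => param d (z.1.2 + (coord c s - z.1.1) *m z.2)).

End InducedCharts.

(** * Partial derivatives in the induced coordinates *)

Section Partials.
Context {R : realType} {p n : nat}.
Implicit Types (f : coords R p n -> R).

Definition dt (a : 'I_p) f : coords R p n -> R :=
  fun z => 'D_((delta_mx 0 a, 0, 0) : coords R p n) f z.
Definition dx (i : 'I_n) f : coords R p n -> R :=
  fun z => 'D_((0, delta_mx 0 i, 0) : coords R p n) f z.
Definition dv (a : 'I_p) (i : 'I_n) f : coords R p n -> R :=
  fun z => 'D_((0, 0, delta_mx a i) : coords R p n) f z.

End Partials.

(** * Metrical multi-time Lagrange spaces *)

Record ML_space (R : realType) (p n : nat) (T : manifold R p) (M : manifold R n)
    (h : metric T) := MLSpace {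
  lagrangian : T * set (T -> M) -> R;
  (* components of g in a chart of M, as functions on J^1(T, M) *)
  fundamental : chart R n M -> T * set (T -> M) -> 'M[R]_n;
  lagrangian_smooth : forall c d, atlas c -> atlas d ->
    smooth_on (jet_dom c d) (fun z => lagrangian (jet_of c d z));
  fundamental_smooth : forall c d, atlas c -> atlas d -> forall i j,
    smooth_on (jet_dom c d) (fun z => fundamental d (jet_of c d z) i j);
  fundamental_tensor : forall d d' t (f : T -> M), atlas d -> atlas d' ->
    smooth_near t f -> dom d (f t) -> dom d' (f t) ->
    fundamental d (jet t f) =
    transition_jac d d' (f t) *m fundamental d' (jet t f)
      *m (transition_jac d d' (f t))^T;
  fundamental_sym : forall c d, atlas c -> atlas d -> forall z, jet_dom c d z ->
    (fundamental d (jet_of c d z))^T = fundamental d (jet_of c d z);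
  fundamental_rank : forall c d, atlas c -> atlas d -> forall z, jet_dom c d z ->
    \rank (fundamental d (jet_of c d z)) = n;
  fundamental_sign : exists q, forall c d, atlas c -> atlas d ->
    forall z, jet_dom c d z -> has_signature q (fundamental d (jet_of c d z));
  kronecker_regular : forall c d, atlas c -> atlas d ->
    forall z, jet_dom c d z -> forall a b i j,
    2^-1 * dv a i (dv b j (fun w => lagrangian (jet_of c d w))) z =
    invmx (h c (param c z.1.1)) a b * fundamental d (jet_of c d z) i j
}.

(** * Coordinate expressions *)

(* Coordinate expressions of h, g, L and of the spatial components of a
   nonlinear connection; [nconn a i j] is N^(i)_(a)j. *)
Record local_geom (R : realType) (p n : nat) := LocalGeom {
  hl : 'rV[R]_p -> 'M[R]_p;
  gl : coords R p n -> 'M[R]_n;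
  Ll : coords R p n -> R;
  nconn : 'I_p -> 'I_n -> 'I_n -> coords R p n -> R
}.

Section MetricObjects.
Context {R : realType} {p n : nat}.
Variables (h : 'rV[R]_p -> 'M[R]_p) (g : coords R p n -> 'M[R]_n).
Implicit Types (z : coords R p n).

Definition hinv (a b : 'I_p) z : R := invmx (h z.1.1) a b.
Definition ginv (i j : 'I_n) z : R := invmx (g z) i j.
Definition gdn (i j : 'I_n) z : R := g z i j.

Definition dh (e a b : 'I_p) z : R := 'D_(delta_mx 0 e) (fun s => h s a b) z.1.1.

(* H^c_ab *)
Definition christoffel_h (c a b : 'I_p) z : R :=
  \sum_e hinv c e z / 2 * (dh b e a z + dh a e b z - dh e a b z).

(* Gamma^i_jk *)
Definition christoffel_g (i j k : 'I_n) z : R :=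
  \sum_m ginv i m z / 2
    * (dx k (gdn m j) z + dx j (gdn m k) z - dx m (gdn j k) z).

(* M^(i)_(a)b *)
Definition Mconn (a b : 'I_p) (i : 'I_n) z : R :=
  - \sum_c christoffel_h c a b z * z.2 c i.

End MetricObjects.

Section Canonical1.
Context {R : realType} {n : nat}.
Variables (h : 'rV[R]_1 -> 'M[R]_1) (g : coords R 1 n -> 'M[R]_n)
  (L : coords R 1 n -> R).

Let H111 := christoffel_h (n := n) h ord0 ord0 ord0.

Definition spray (i : 'I_n) (z : coords R 1 n) : R :=
  \sum_k ginv g i k z / 4 *
    ((\sum_j dx j (dv ord0 k L) z * z.2 ord0 j) - dx k L z
     + dt ord0 (dv ord0 k L) z + dv ord0 k L z * H111 z
     + 2 * hinv h ord0 ord0 z * H111 z * \sum_l g z k l * z.2 ord0 l).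

Definition Nconn1 (a : 'I_1) (i j : 'I_n) (z : coords R 1 n) : R :=
  h z.1.1 ord0 ord0 * dv ord0 j (spray i) z.

End Canonical1.

Section CanonicalMulti.
Context {R : realType} {p n : nat}.
Variables (h : 'rV[R]_p -> 'M[R]_p) (g : coords R p n -> 'M[R]_n)
  (L : coords R p n -> R).

(* U^(a)_(i)(t, x), the coefficient of x^i_a in
   L = h^ab g_ij x^i_a x^j_b + U^(a)_(i) x^i_a + F, extracted as the derivative
   of L at zero velocity. *)
Definition Ucoef (a : 'I_p) (i : 'I_n) (z : coords R p n) : R :=
  dv a i L (z.1, 0).

(* U^(b)_(k)j *)
Definition Ucurl (b : 'I_p) (k j : 'I_n) (z : coords R p n) : R :=
  dx j (Ucoef b k) z - dx k (Ucoef b j) z.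

Definition Nconn_multi (a : 'I_p) (i j : 'I_n) (z : coords R p n) : R :=
  (\sum_k christoffel_g g i j k z * z.2 a k)
  + (\sum_k ginv g i k z / 2 * dt a (gdn g j k) z)
  + \sum_k \sum_b ginv g i k z / 4 * h z.1.1 a b * Ucurl b k j z.

End CanonicalMulti.

Section Cartan.
Context {R : realType} {p n : nat} (K : local_geom R p n).
Implicit Types (f : coords R p n -> R) (z : coords R p n).

Let N := nconn K.
Let H : 'I_p -> 'I_p -> 'I_p -> coords R p n -> R := christoffel_h (hl K).
Let ginv := ginv (gl K).
Let gdn := gdn (gl K).

(* delta / delta t^c and delta / delta x^i *)
Definition adt (c : 'I_p) f z : R :=
  dt c f z - \sum_b \sum_j Mconn (hl K) b c j z * dv b j f z.
Definition adx (i : 'I_n) f z : R :=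
  dx i f z - \sum_b \sum_j N b j i z * dv b j f z.

(* G^k_jc, L^i_jk and C^i(c)_j(k) *)
Definition Gcart (k j : 'I_n) (c : 'I_p) z : R :=
  \sum_i ginv k i z / 2 * adt c (gdn i j) z.
Definition Lcart (i j k : 'I_n) z : R :=
  \sum_m ginv i m z / 2
    * (adx k (gdn m j) z + adx j (gdn m k) z - adx m (gdn j k) z).
Definition Ccart (i : 'I_n) (c : 'I_p) (j k : 'I_n) z : R :=
  \sum_m ginv i m z / 2
    * (dv c k (gdn m j) z + dv c j (gdn m k) z - dv c m (gdn j k) z).

(* Covariant derivatives; the name lists the index positions of the argument,
   t / x for temporal / spatial and U / D for up / down, in the order of its
   arguments. The derivative index comes last. *)
Definition covt_tU_xD (A : 'I_p -> 'I_n -> coords R p n -> R)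
    (a : 'I_p) (i : 'I_n) (c : 'I_p) z : R :=
  adt c (A a i) z + (\sum_m H a m c z * A m i z)
  - \sum_m Gcart m i c z * A a m z.
Definition covt_tU_xDD (A : 'I_p -> 'I_n -> 'I_n -> coords R p n -> R)
    (a : 'I_p) (i j : 'I_n) (c : 'I_p) z : R :=
  adt c (A a i j) z + (\sum_m H a m c z * A m i j z)
  - (\sum_m Gcart m i c z * A a m j z) - \sum_m Gcart m j c z * A a i m z.

Definition covx_tU_xD (A : 'I_p -> 'I_n -> coords R p n -> R)
    (a : 'I_p) (i k : 'I_n) z : R :=
  adx k (A a i) z - \sum_m Lcart m i k z * A a m z.
Definition covx_tU_xD_tD (A : 'I_p -> 'I_n -> 'I_p -> coords R p n -> R)
    (a : 'I_p) (i : 'I_n) (b : 'I_p) (k : 'I_n) z : R :=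
  adx k (A a i b) z - \sum_m Lcart m i k z * A a m b z.
Definition covx_tU_xDD (A : 'I_p -> 'I_n -> 'I_n -> coords R p n -> R)
    (a : 'I_p) (i j k : 'I_n) z : R :=
  adx k (A a i j) z - (\sum_m Lcart m i k z * A a m j z)
  - \sum_m Lcart m j k z * A a i m z.
Definition covx_xU_tD_xD (A : 'I_n -> 'I_p -> 'I_n -> coords R p n -> R)
    (r : 'I_n) (b : 'I_p) (i k : 'I_n) z : R :=
  adx k (A r b i) z + (\sum_m Lcart r m k z * A m b i z)
  - \sum_m Lcart m i k z * A r b m z.

Definition covv_tU_xD (A : 'I_p -> 'I_n -> coords R p n -> R)
    (a : 'I_p) (i : 'I_n) (c : 'I_p) (k : 'I_n) z : R :=
  dv c k (A a i) z - \sum_m Ccart m c i k z * A a m z.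
Definition covv_tU_xDD (A : 'I_p -> 'I_n -> 'I_n -> coords R p n -> R)
    (a : 'I_p) (i j : 'I_n) (c : 'I_p) (k : 'I_n) z : R :=
  dv c k (A a i j) z - (\sum_m Ccart m c i k z * A a m j z)
  - \sum_m Ccart m c j k z * A a i m z.

(* T^m_aj *)
Definition Ttors (m : 'I_n) (a : 'I_p) (j : 'I_n) z : R := - Gcart m j a z.

(* G^(a)(b)_(i)(j) *)
Definition Gvert (a : 'I_p) (i : 'I_n) (b : 'I_p) (j : 'I_n) z : R :=
  2^-1 * dv a i (dv b j (Ll K)) z.

(* x^(a)_(i) *)
Definition xlow (a : 'I_p) (i : 'I_n) z : R :=
  \sum_c \sum_k Gvert a i c k z * z.2 c k.

(* Dbar^(a)_(i)b, D^(a)_(i)j and d^(a)(b)_(i)(j) *)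
Definition Dbar (a : 'I_p) (i : 'I_n) (b : 'I_p) : coords R p n -> R :=
  covt_tU_xD xlow a i b.
Definition Ddefl (a : 'I_p) (i j : 'I_n) : coords R p n -> R :=
  covx_tU_xD xlow a i j.
Definition ddefl (a : 'I_p) (i : 'I_n) (b : 'I_p) (j : 'I_n) :
  coords R p n -> R := covv_tU_xD xlow a i b j.

(* F^(a)_(i)j *)
Definition Fem (a : 'I_p) (i j : 'I_n) z : R :=
  2^-1 * (Ddefl a i j z - Ddefl a j i z).

End Cartan.

Section Torsion1.
Context {R : realType} {n : nat} (K : local_geom R 1 n).
Implicit Types z : coords R 1 n.

(* R^(m)_(a)bj; all temporal indices are 1 *)
Definition Rt1 (m : 'I_n) (a b : 'I_1) (j : 'I_n) z : R :=
  - dt ord0 (nconn K ord0 m j) z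
  + christoffel_h (hl K) ord0 ord0 ord0 z
    * (nconn K ord0 m j z
       - \sum_k dv ord0 k (nconn K ord0 m j) z * z.2 ord0 k).

(* R^(m)_(1)ij *)
Definition Rx1 (m i j : 'I_n) z : R :=
  adx K j (nconn K ord0 m i) z - adx K i (nconn K ord0 m j) z.

(* C^(1)(1)(1)_(i)(l)(m), normalized so that it is the vertical derivative of
   G^(1)(1)_(i)(l); it is twice the lowered Cartan coefficient
   G^(1)(1)_(l)(q) C^q(1)_i(m). *)
Definition Cvert (i l m : 'I_n) z : R :=
  2^-1 * dv ord0 i (dv ord0 l (dv ord0 m (Ll K))) z.

End Torsion1.

(* R^(m)_(mu)aj for p >= 2 *)
Definition Rt_multi (R : realType) (p n : nat) (K : local_geom R p n)
    (m : 'I_n) (mu a : 'I_p) (j : 'I_n) (z : coords R p n) : R :=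
  - dt a (nconn K mu m j) z
  + \sum_k \sum_b ginv (gl K) m k z / 2 * christoffel_h (hl K) b mu a z
    * (dt b (gdn (gl K) j k) z
       + \sum_c hl K z.1.1 b c / 2 * Ucurl (Ll K) c k j z).

(** * Coordinate expressions of a metrical multi-time Lagrange space *)

Section LocalExpressions.
Context {R : realType} {p n : nat} {T : manifold R p} {M : manifold R n}.
Context {h : metric T} (S : ML_space M h).
Variables (c : chart R p T) (d : chart R n M).

Definition h_loc (s : 'rV[R]_p) : 'M[R]_p := h c (param c s).
Definition g_loc (z : coords R p n) : 'M[R]_n := fundamental S d (jet_of c d z).
Definition L_loc (z : coords R p n) : R := lagrangian S (jet_of c d z).

Definition canonical_multi : local_geom R p n :=
  LocalGeom h_loc g_loc L_loc (Nconn_multi h_loc g_loc L_loc).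

End LocalExpressions.

Definition canonical1 (R : realType) (n : nat) (T : manifold R 1)
    (M : manifold R n) (h : metric T) (S : ML_space M h)
    (c : chart R 1 T) (d : chart R n M) : local_geom R 1 n :=
  let h' := h_loc (h := h) c in let g' := g_loc S c d in
  let L' := L_loc S c d in LocalGeom h' g' L' (Nconn1 h' g' L').

(** * Alternate and cyclic sums *)

Definition alternate (R : realType) (n : nat) (E : 'I_n -> 'I_n -> R)
    (i k : 'I_n) : R := E i k - E k i.
Definition cyclic (R : realType) (n : nat) (E : 'I_n -> 'I_n -> 'I_n -> R)
    (i j k : 'I_n) : R := E i j k + E j k i + E k i j.

(* The right-hand side common to the cases p = 1 and p >= 2 of the first Maxwell
   equation, where [Rt] stands for the torsion R^(m)_(mu)bk. *)
Definition maxwell_rhs (R : realType) (p n : nat) (K : local_geom R p n)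
    (Rt : 'I_n -> 'I_p -> 'I_p -> 'I_n -> coords R p n -> R)
    (a b : 'I_p) (z : coords R p n) (i k : 'I_n) : R :=
  2^-1 * alternate (fun i k =>
    covx_tU_xD_tD K (Dbar K) a i b k z
    + (\sum_m Ddefl K a i m z * Ttors K m b k z)
    + (\sum_m \sum_mu ddefl K a i mu m z * Rt m mu b k z)
    - \sum_r (covx_xU_tD_xD K (Ttors K) r b i k z
              + \sum_m \sum_mu Ccart K r mu k m z * Rt m mu b i z)
             * xlow K a r z) i k.

(* Main.v *)
(* The adapted derivatives d/dt^b, d/dx^k of the nonlinear connection are vector
   fields D_u - a^j_c d/dx^j_c, and [d/dt, d/dx], [d/dx, d/dx] are the vertical
   fields with components the torsions R.  As the Cartan coefficients L are
   symmetric, 2 F_ij = d_j x_i - d_i x_j for the lowered velocity x_i, so the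
   first Maxwell equation is the commutation of d/dt and d/dx on x_i, and the
   cyclic sum of F_(i)j|k is -1/2 times that of R^m_jk dx_i/dv^m.  In the latter
   the part R^m_jk G_im has zero cyclic sum because the horizontal spaces are
   Lagrangian for d(dL/dv^i dx^i), i.e. d_j (dL/dv^i) is symmetric in i, j; what
   remains is the third derivative of L along v, which vanishes for p >= 2. *)

(* The canonical N is exactly what makes d_j (dL/dv^i) symmetric in i, j. Contracted with the
   vertical Hessian of L, N has the same antisymmetric part as the partial derivative of dL/dv^i by
   x^j, so subtracting it leaves a symmetric expression. For p = 1 this is because N is a vertical
   derivative of the semispray; for p >= 2 it fixes the factor 1/4 before the curl of U.

   The definition of the space supplies only Kronecker regularity. For p >= 2 the independence of g
   from the velocities and the affine form of dL/dv are therefore derived: the first from the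
   symmetry of the third vertical derivatives of L, the second by integration along the fibres,
   which are full vector spaces.

   [smooth_on] speaks only of iterated directional derivatives, so their symmetry is proved from the
   mean value theorem. Coordinate expressions are meaningful only on the open set [jet_dom], so the
   tensor algebra is done in an abstract [calculus] tied to such a region and reaches coordinates by
   conversion. *)
Require Import Defs.
From HB Require Import structures.
From mathcomp Require Import all_boot all_order all_algebra.
From mathcomp Require Import all_classical all_reals all_analysis.
From mathcomp Require Import ring.
Import Order.TTheory GRing.Theory Num.Theory.
Import numFieldNormedType.Exports.
Local Open Scope classical_set_scope.
Local Open Scope ring_scope.

Set Implicit Arguments.
Unset Strict Implicit.
Unset Printing Implicit Defensive.

(** * Closure properties of smooth functions on an open set *)

Section SmoothCalculus.
Context {R : realType} {V : normedModType R}.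
Variables (A : set V).
Hypothesis A_open : open A.
Implicit Types (f g : V -> R) (x u v : V).

(** Smoothness graded by order. A product rule for [iter_derive] along a list would produce sums
    over sublists; with [ck] each closure property is an induction on k that applies the rule for
    one derivative once. *)
Fixpoint ck (k : nat) (f : V -> R) : Prop :=
  (forall x, A x -> {for x, continuous f}) /\
  if k is k'.+1 then
    forall v, (forall x, A x -> derivable f x v) /\ ck k' (fun x => 'D_v f x)
  else True.

Lemma near_open x : A x -> \forall y \near x, A y.
Proof. by move=> Ax; apply: open_nbhs_nbhs. Qed.

Lemma smooth_on_derive f v : smooth_on A f -> smooth_on A (fun x => 'D_v f x).
Proof.
move=> sf vs x Ax; have := sf (rcons vs v) x Ax.
by rewrite /iter_derive foldr_rcons.
Qed.

Lemma smooth_on_cts f x : smooth_on A f -> A x -> {for x, continuous f}.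
Proof. by move=> sf Ax; have [] := sf [::] x Ax. Qed.

Lemma smooth_on_derivable f v x : smooth_on A f -> A x -> derivable f x v.
Proof. by move=> sf Ax; have [] := sf [::] x Ax. Qed.

Lemma smooth_onP f : smooth_on A f <-> forall k, ck k f.
Proof.
split=> [sf k|].
  elim: k f sf => [|k IH] f sf /=.
    by split=> // x Ax; apply: smooth_on_cts.
  split=> [x Ax|v]; first exact: smooth_on_cts.
  by split=> [x Ax|]; [exact: smooth_on_derivable|exact/IH/smooth_on_derive].
(* [iter_derive] differentiates along the last vector of the list first, so induction from the right
   end peels a derivative off [f] itself. *)
move=> ckf vs; elim/last_ind: vs f ckf => [|vs v IH] f ckf x Ax.
  split; first by have [/(_ x Ax)] := ckf 0%N.
  by move=> v; have [_ /(_ v) [/(_ x Ax)]] := ckf 1%N.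
have := IH ('D_v f); rewrite /iter_derive foldr_rcons; apply=> // k.
by have [_ /(_ v) []] := ckf k.+1.
Qed.

Lemma near_eq_on f g x : (forall y, A y -> f y = g y) -> A x ->
  \forall y \near x, f y = g y.
Proof. by move=> fg /near_open; apply: filterS. Qed.

Lemma derive_eq_on f g v x : (forall y, A y -> f y = g y) -> A x ->
  'D_v f x = 'D_v g x.
Proof. by move=> fg Ax; apply: near_eq_derive; apply: near_eq_on. Qed.

(** Every clause of [ck] is local at points of the open set A. Formulas valid only on A, such as the
    product and quotient rules, may thus stand for the derivatives themselves. *)
Lemma ck_eq k f g : (forall y, A y -> f y = g y) -> ck k f -> ck k g.
Proof.
elim: k f g => [|k IH] f g fg /=; case=> cf df; split=> //.
- move=> x Ax; rewrite /prop_for /continuous_at -(fg _ Ax).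
  by apply: cvg_trans (cf x Ax); apply: near_eq_cvg; apply: near_eq_on.
- move=> x Ax; rewrite /prop_for /continuous_at -(fg _ Ax).
  by apply: cvg_trans (cf x Ax); apply: near_eq_cvg; apply: near_eq_on.
- move=> v; have [dfv ckf] := df v; split=> [x Ax|].
    by apply: near_eq_derivable (dfv x Ax); apply: near_eq_on.
  by apply: IH ckf => y Ay; apply: derive_eq_on.
Qed.

Lemma smooth_on_eq f g : (forall y, A y -> f y = g y) ->
  smooth_on A f -> smooth_on A g.
Proof. by move=> fg /smooth_onP sf; apply/smooth_onP => k; apply: ck_eq (sf k). Qed.

Lemma ckS k f : ck k.+1 f -> ck k f.
Proof.
elim: k f => [|k IH] f [cf df]; split=> // v.
by have [? ?] := df v; split=> //; apply: IH.
Qed.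

Lemma ck_cst k (a : R) : ck k (fun=> a).
Proof.
elim: k a => [|k IH] a; split=> //; try by move=> x _; apply: cvg_cst.
move=> v; split=> [x _|]; first exact: derivable_cst.
by apply: ck_eq (IH 0) => y _; rewrite derive_cst.
Qed.

Lemma ckD k f g : ck k f -> ck k g -> ck k (fun x => f x + g x).
Proof.
elim: k f g => [|k IH] f g [cf df] [cg dg]; split=> //;
  try by move=> x Ax; apply: cvgD; [exact: cf|exact: cg].
move=> v; have [df1 df2] := df v; have [dg1 dg2] := dg v; split=> [x Ax|].
  by apply: derivableD; [exact: df1|exact: dg1].
apply: ck_eq (IH _ _ df2 dg2) => y Ay.
by rewrite -deriveD//; [exact: df1|exact: dg1].
Qed.

Lemma ckM k f g : ck k f -> ck k g -> ck k (fun x => f x * g x).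
Proof.
elim: k f g => [|k IH] f g ckf ckg; move: (ckf) (ckg) => [cf df] [cg dg];
  split=> //; try by move=> x Ax; apply: cvgM; [exact: cf|exact: cg].
move=> v; have [df1 df2] := df v; have [dg1 dg2] := dg v; split=> [x Ax|].
  by apply: derivableM; [exact: df1|exact: dg1].
apply: ck_eq (ckD (IH _ _ (ckS ckf) dg2) (IH _ _ (ckS ckg) df2)) => y Ay.
by rewrite (@deriveM _ _ f g)//; [exact: df1|exact: dg1].
Qed.

Lemma ckN k f : ck k f -> ck k (fun x => - f x).
Proof.
by move=> /(ckM (ck_cst k (-1))); apply: ck_eq => y _; rewrite mulN1r.
Qed.

(** The derivative of 1/f is - (1/f) (1/f) f', which involves 1/f only at the previous order; hence
    f stays fixed in the induction on k. *)
Lemma ckV k f : (forall x, A x -> f x != 0) -> ck k f -> ck k (fun x => (f x)^-1).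
Proof.
move=> f0; elim: k => [|k IH] ckf; move: (ckf) => [cf df]; split=> //;
  try by move=> x Ax; apply: cvgV; [exact: f0|exact: cf].
move=> v; have [df1 df2] := df v; split=> [x Ax|].
  by apply: derivableV; [exact: f0|exact: df1].
have ckVf := IH (ckS ckf).
apply: ck_eq (ckM (ckN (ckM ckVf ckVf)) df2) => y Ay.
rewrite deriveV//; [|exact: f0|exact: df1].
by rewrite -exprVn expr2.
Qed.

Lemma smooth_on_cst (a : R) : smooth_on A (fun=> a).
Proof. by apply/smooth_onP => k; apply: ck_cst. Qed.

Lemma smooth_onD f g : smooth_on A f -> smooth_on A g ->
  smooth_on A (fun x => f x + g x).
Proof.
by move=> /smooth_onP sf /smooth_onP sg; apply/smooth_onP => k; apply: ckD.
Qed.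

Lemma smooth_onM f g : smooth_on A f -> smooth_on A g ->
  smooth_on A (fun x => f x * g x).
Proof.
by move=> /smooth_onP sf /smooth_onP sg; apply/smooth_onP => k; apply: ckM.
Qed.

Lemma smooth_onN f : smooth_on A f -> smooth_on A (fun x => - f x).
Proof. by move=> /smooth_onP sf; apply/smooth_onP => k; apply: ckN. Qed.

Lemma smooth_onB f g : smooth_on A f -> smooth_on A g ->
  smooth_on A (fun x => f x - g x).
Proof. by move=> sf sg; exact: smooth_onD sf (smooth_onN sg). Qed.

Lemma smooth_onV f : (forall x, A x -> f x != 0) -> smooth_on A f ->
  smooth_on A (fun x => (f x)^-1).
Proof.
by move=> f0 /smooth_onP sf; apply/smooth_onP => k; apply: ckV.
Qed.

Lemma smooth_on_sum (I : Type) (r : seq I) (P : pred I) (F : I -> V -> R) :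
  (forall i, smooth_on A (F i)) -> smooth_on A (fun x => \sum_(i <- r | P i) F i x).
Proof.
move=> sF; elim: r => [|i r IH].
  by apply: smooth_on_eq (smooth_on_cst 0) => y _; rewrite big_nil.
have [Pi|nPi] := boolP (P i).
  by apply: smooth_on_eq (smooth_onD (sF i) IH) => y _; rewrite big_cons Pi.
by apply: smooth_on_eq IH => y _; rewrite big_cons (negPf nPi).
Qed.

Lemma smooth_on_prod (I : Type) (r : seq I) (P : pred I) (F : I -> V -> R) :
  (forall i, smooth_on A (F i)) -> smooth_on A (fun x => \prod_(i <- r | P i) F i x).
Proof.
move=> sF; elim: r => [|i r IH].
  by apply: smooth_on_eq (smooth_on_cst 1) => y _; rewrite big_nil.
have [Pi|nPi] := boolP (P i).
  by apply: smooth_on_eq (smooth_onM (sF i) IH) => y _; rewrite big_cons Pi.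
by apply: smooth_on_eq IH => y _; rewrite big_cons (negPf nPi).
Qed.

Lemma smooth_on_det m (B : V -> 'M[R]_m) : (forall i j, smooth_on A (fun x => B x i j)) ->
  smooth_on A (fun x => \det (B x)).
Proof.
move=> sB; rewrite /determinant; apply: smooth_on_sum => s.
by apply: smooth_onM; [exact: smooth_on_cst|exact: smooth_on_prod].
Qed.

Lemma smooth_on_invmx m (B : V -> 'M[R]_m) :
  (forall i j, smooth_on A (fun x => B x i j)) ->
  (forall x, A x -> B x \in unitmx) ->
  forall i j, smooth_on A (fun x => invmx (B x) i j).
Proof.
move=> sB uB i j.
(* By Cramer's rule the entries of the inverse are rational in those of B, with a denominator that
   does not vanish on A. *)
apply: (@smooth_on_eq (fun x => (\det (B x))^-1 * cofactor (B x) j i)) => [x Ax|].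
  by rewrite /invmx uB// !mxE.
apply: smooth_onM; first apply: smooth_onV; last 1 first.
- apply: smooth_onM; first exact: smooth_on_cst.
  apply: smooth_on_det => a b; under eq_fun do rewrite !mxE; exact: sB.
- by move=> x /uB; rewrite unitmxE unitfE.
- exact: smooth_on_det.
Qed.

Section DeriveSmooth.
Variables (x : V) (v : V).
Hypothesis Ax : A x.

Lemma derive_onD f g : smooth_on A f -> smooth_on A g ->
  'D_v (fun y => f y + g y) x = 'D_v f x + 'D_v g x.
Proof. by move=> sf sg; apply: deriveD; apply: smooth_on_derivable. Qed.

Lemma derive_onM f g : smooth_on A f -> smooth_on A g ->
  'D_v (fun y => f y * g y) x = 'D_v f x * g x + f x * 'D_v g x.
Proof.
move=> sf sg; rewrite (@deriveM _ _ f g); try exact: smooth_on_derivable.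
by rewrite addrC /GRing.scale/= (mulrC (g x)).
Qed.

End DeriveSmooth.

End SmoothCalculus.

(** * Mean value theorem on lines and symmetry of second derivatives *)

Section LineMVT.
Context {R : realType} {V : normedModType R}.
Implicit Types (f : V -> R) (x u v : V).

Lemma is_derive_line f x u (s : R) : derivable f (s *: u + x) u ->
  is_derive s 1 (fun r : R => f (r *: u + x)) ('D_u f (s *: u + x)).
Proof.
move=> df.
have E : (fun h : R => h^-1 *: (((fun r => f (r *: u + x)) \o shift s) (h *: 1)
     - f (s *: u + x))) =
   (fun h => h^-1 *: ((f \o shift (s *: u + x)) (h *: u) - f (s *: u + x))).
  apply/funext => h /=; congr (_ *: (f _ - _)).
  by rewrite [h *: 1]mulr1 scalerDl addrA.
by split; rewrite /derivable /derive E.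
Qed.

Lemma line_MVT f x u (s : R) : 0 <= s ->
  (forall r, 0 <= r <= s -> derivable f (r *: u + x) u) ->
  exists2 r, 0 <= r <= s & f (s *: u + x) - f x = s * 'D_u f (r *: u + x).
Proof.
move=> s0 df.
have df' r : r \in `[0, s] -> is_derive r 1 (fun r : R => f (r *: u + x))
    ('D_u f (r *: u + x)).
  by rewrite in_itv/= => /df; apply: is_derive_line.
pose F (r : R) : R := f (r *: u + x).
pose G (r : R) : R := 'D_u f (r *: u + x).
have dF r : r \in `]0, s[ -> is_derive r 1 F (G r).
  by move=> rs; apply: df'; exact: subset_itv_oo_cc.
have cF : {within `[0, s], continuous F}.
  by apply: derivable_within_continuous => r rs; have [] := df' r rs.
have [r rs E] := @MVT_segment R F G 0 s s0 dF cF.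
exists r; first by move: rs; rewrite in_itv.
by move: E; rewrite /F scale0r add0r subr0 mulrC.
Qed.

End LineMVT.

Section Schwarz.
Context {R : realType} {V : normedModType R}.
Variables (A : set V).
Hypothesis A_open : open A.
Implicit Types (f : V -> R) (x u v : V).

Lemma near_parallelogram (B : set V) x u v : nbhs x B ->
  \forall s \near (0 : R)^'+, forall r r', 0 <= r <= s -> 0 <= r' <= s ->
    B (r *: u + r' *: v + x).
Proof.
move=> /nbhs_ballP [e /= e0 eB]; near=> s => r r' /andP[r0 rs] /andP[r'0 r's].
apply: eB; rewrite -ball_normE/= opprD addrCA subrr addr0 normrN.
apply: le_lt_trans (ler_normD _ _) _; rewrite !normrZ !ger0_norm//.
apply: (@le_lt_trans _ _ (s * (`|u| + `|v|))).
  by rewrite mulrDr lerD// ler_wpM2r.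
(* The summand 1 keeps the divisor positive when u and v are both zero. *)
have D0 : 0 < `|u| + `|v| + 1 by rewrite ltr_wpDl// addr_ge0.
have s0 : 0 < s by near: s; apply: nbhs_right_gt.
apply: (@lt_le_trans _ _ (s * (`|u| + `|v| + 1))).
  by rewrite ltr_pM2l// ltrDl.
rewrite -ler_pdivlMr//; near: s; apply: nbhs_right_le; exact: divr_gt0.
Unshelve. all: by end_near. Qed.

(** Two mean value steps: the increment of f along s v is a function F whose increment along u is
    estimated first, and the resulting difference of D_u f is then an increment along v. *)
Lemma second_difference f x u v (s : R) : smooth_on A f -> 0 <= s ->
  (forall r r', 0 <= r <= s -> 0 <= r' <= s -> A (r *: u + r' *: v + x)) ->
  exists r r', [/\ 0 <= r <= s, 0 <= r' <= s &
   f (s *: u + s *: v + x) - f (s *: u + x) - (f (s *: v + x) - f x)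
    = s * (s * 'D_v (fun y => 'D_u f y) (r *: u + r' *: v + x))].
Proof.
move=> sf s0 sA.
have E (r r' : R) : r *: u + r' *: v + x = r' *: v + (r *: u + x).
  by rewrite addrCA addrA.
pose F y := f (s *: v + y) - f y.
have shift_der y w : A (s *: v + y) ->
    is_derive y w (fun y => f (s *: v + y)) ('D_w f (s *: v + y)).
  move=> As.
  have E1 : (fun h : R =>
       h^-1 *: (((fun y => f (s *: v + y)) \o shift y) (h *: w) - f (s *: v + y))) =
     (fun h => h^-1 *: ((f \o shift (s *: v + y)) (h *: w) - f (s *: v + y))).
    by apply/funext => h /=; rewrite (addrCA (s *: v)).
  split; rewrite /derivable /derive E1//.
  exact: (smooth_on_derivable sf As).
have ss : 0 <= s <= s by rewrite s0 lexx.
have s0s : 0 <= (0 : R) <= s by rewrite lexx s0.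
have FA r : 0 <= r <= s -> A (r *: u + x) /\ A (s *: v + (r *: u + x)).
  move=> rs; split; first by have := sA r 0 rs s0s; rewrite scale0r addr0.
  by have := sA r s rs ss; rewrite E.
have dF r : 0 <= r <= s -> is_derive (r *: u + x) u F
    ('D_u f (s *: v + (r *: u + x)) - 'D_u f (r *: u + x)).
  move=> /FA [A1 A2]; apply: is_deriveB; first exact: shift_der.
  by apply: derivableP; apply: (smooth_on_derivable sf A1).
have [|r rs Er] := @line_MVT R V F x u s s0.
  by move=> r /dF [].
have [|r' rs' Er'] := @line_MVT R V (fun y => 'D_u f y) (r *: u + x) v s s0.
  move=> r' rs'; apply: (smooth_on_derivable (smooth_on_derive u sf)).
  by have := sA r r' rs rs'; rewrite E.
exists r, r'; split=> //.
have [_ dFr] := dF r rs.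
move: Er; rewrite dFr Er' /F => Er.
by rewrite !E Er.
Qed.

(** Schwarz's theorem. The second difference is symmetric in u and v, so the two mixed derivatives
    take a common value at two points of a small parallelogram at x; continuity of both at x bounds
    their difference at x by any e > 0. *)
Lemma derive_comm f x u v : smooth_on A f -> A x ->
  'D_u (fun y => 'D_v f y) x = 'D_v (fun y => 'D_u f y) x.
Proof.
move=> sf Ax.
have tri (a b c e : R) : `|a - c| < e / 2 -> `|b - c| < e / 2 -> `|a - b| <= e.
  move=> ac bc; rewrite (splitr e) (le_trans (ler_distD c a b))//.
  by rewrite (distrC c) lerD// ltW.
apply/eqP; rewrite -subr_eq0 -normr_le0; apply/ler_addgt0Pr => e e0.
rewrite add0r.
pose G (u v : V) := fun y => 'D_u (fun y => 'D_v f y) y.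
have cG u' v' : \forall y \near x, `|G u' v' x - G u' v' y| < e / 2.
  have : {for x, continuous (G u' v')}.
    by apply: smooth_on_cts Ax; do 2 apply: smooth_on_derive.
  by move/cvgrPdist_lt; apply; rewrite divr_gt0.
pose B := A `&` ([set y | `|G u v x - G u v y| < e / 2] `&`
                [set y | `|G v u x - G v u y| < e / 2]).
have xB : nbhs x B.
  exact: filterI (near_open A_open Ax) (filterI (cG u v) (cG v u)).
have [s [s0 [N1 N2]]] := filter_ex
  (filterI (nbhs_right_gt (0 : R))
    (filterI (near_parallelogram u v xB) (near_parallelogram v u xB))).
have [|r1 [r1' [r1s r1s' E1]]] := @second_difference f x u v s sf (ltW s0).
  by move=> r r' rs rs'; have [] := N1 r r' rs rs'.
have [|r2 [r2' [r2s r2s' E2]]] := @second_difference f x v u s sf (ltW s0).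
  by move=> r r' rs rs'; have [] := N2 r r' rs rs'.
have [_ [_ /= B1]] := N1 _ _ r1s r1s'.
have [_ [/= B2 _]] := N2 _ _ r2s r2s'.
have : G v u (r1 *: u + r1' *: v + x) = G u v (r2 *: v + r2' *: u + x).
  apply: (mulfI (lt0r_neq0 s0)); apply: (mulfI (lt0r_neq0 s0)).
  by rewrite -[LHS]E1 -[RHS]E2 (addrC (s *: v) (s *: u)); ring.
move=> E; move: B1; rewrite /= E => B1.
exact: tri B2 B1.
Qed.

Lemma derive0_line f x u (s : R) : smooth_on A f -> (forall r : R, A (r *: u + x)) ->
  (forall y, A y -> 'D_u f y = 0) -> f (s *: u + x) = f x.
Proof.
move=> sf Al d0.
suff H (t : R) y : 0 <= t -> (forall r : R, A (r *: u + y)) -> f (t *: u + y) = f y.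
  (* For negative s the same line is run backwards from its other end point. *)
  have [/H->//|/ltW s0] := leP 0 s.
  rewrite -(H (- s) (s *: u + x)) ?oppr_ge0//.
    by rewrite addrA -scalerDl addNr scale0r add0r.
  by move=> r; rewrite addrA -scalerDl.
move=> t0 Ay; apply/eqP; rewrite -subr_eq0; apply/eqP.
have [|r _ ->] := line_MVT t0 (f := f) (x := y) (u := u).
  by move=> r _; apply: smooth_on_derivable sf _.
by rewrite d0// mulr0.
Qed.

End Schwarz.

(** * Pullback along linear maps *)

Section LinearPullback.
Context {R : realType} {V W : normedModType R}.
Variable pi : V -> W.
Hypothesis pi_lin : forall (a : R) x y, pi (a *: x + y) = a *: pi x + pi y.
Implicit Types (f : W -> R).

Lemma growth_rate_pullback f v x :
  (fun h : R => h^-1 *: (((f \o pi) \o shift x) (h *: v) - (f \o pi) x)) =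
  (fun h => h^-1 *: ((f \o shift (pi x)) (h *: pi v) - f (pi x))).
Proof. by apply/funext => h /=; rewrite pi_lin. Qed.

Lemma derive_pullback f v x : 'D_v (fun y => f (pi y)) x = 'D_(pi v) f (pi x).
Proof. by rewrite /derive -growth_rate_pullback. Qed.

Lemma derivable_pullback f v x :
  derivable f (pi x) (pi v) -> derivable (fun y => f (pi y)) x v.
Proof. by rewrite /derivable -growth_rate_pullback. Qed.

(** Derivatives of [f \o pi] along vs are derivatives of f along the images of vs. It will be
    applied to the projection onto t, for h and its Christoffel symbols, and to the map that sets
    the velocity to zero, for [Ucoef]. *)
Lemma smooth_on_pullback (A : set V) (B : set W) f : continuous pi ->
  (forall x, A x -> B (pi x)) -> smooth_on B f -> smooth_on A (fun x => f (pi x)).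
Proof.
move=> cpi AB sf vs x Ax.
have -> : iter_derive vs (fun y => f (pi y)) =
          (fun y => iter_derive (map pi vs) f (pi y)).
  elim: vs => //= v vs ->; apply/funext => y; exact: derive_pullback.
have [cf df] := sf (map pi vs) (pi x) (AB x Ax); split.
  by apply: (@continuous_comp _ _ _ pi); [exact: cpi|exact: cf].
by move=> v; apply: derivable_pullback; apply: df.
Qed.

End LinearPullback.

Lemma smooth_on_id (R : realType) : smooth_on [set: R] (fun x : R => x).
Proof.
apply/smooth_onP => -[|k]; split=> //; try by move=> x _; apply: cvg_id.
move=> v; split=> [x _|]; first exact: derivable_id.
by apply: (ck_eq openT _ (ck_cst openT k v)) => y _; rewrite derive_id.
Qed.

Section LinearForm.
Context {R : realType} {V : normedModType R}.
Variable phi : V -> R.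
Hypothesis phi_lin : forall (a : R) x y, phi (a *: x + y) = a * phi x + phi y.

Lemma smooth_on_linear (A : set V) : continuous phi -> smooth_on A phi.
Proof.
move=> cphi.
exact: (@smooth_on_pullback R V R phi phi_lin A setT idfun cphi (fun _ _ => I)
  (@smooth_on_id R)).
Qed.

Lemma derive_linear v x : 'D_v phi x = phi v.
Proof.
have := @derive_pullback R V R phi phi_lin (fun y : R => y) v x.
by move=> ->; apply: derive_id.
Qed.

End LinearForm.

(* Models smooth functions on an open set [region]: functions agreeing there are
   identified, and the values elsewhere play no role. *)
Record calculus (R : realType) (Z W : Type) := Calculus {
  region : Z -> Prop;
  smooth : (Z -> R) -> Prop;
  diff : W -> (Z -> R) -> Z -> R;
  smooth_cst : forall r, smooth (fun=> r);
  smoothD : forall f g, smooth f -> smooth g -> smooth (fun z => f z + g z);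
  smoothM : forall f g, smooth f -> smooth g -> smooth (fun z => f z * g z);
  smooth_eq : forall f g, (forall z, region z -> f z = g z) -> smooth f -> smooth g;
  smooth_diff : forall u f, smooth f -> smooth (diff u f);
  diff_cst : forall u r z, diff u (fun=> r) z = 0;
  diffD : forall u f g z, smooth f -> smooth g -> region z ->
    diff u (fun y => f y + g y) z = diff u f z + diff u g z;
  diffM : forall u f g z, smooth f -> smooth g -> region z ->
    diff u (fun y => f y * g y) z = diff u f z * g z + f z * diff u g z;
  diff_eq : forall u f g z, (forall y, region y -> f y = g y) -> region z ->
    diff u f z = diff u g z;
  diff_comm : forall u w f z, smooth f -> region z ->
    diff u (diff w f) z = diff w (diff u f) z
}.

(** * Vector fields and their commutators in an abstract calculus *)

Section CalculusTheory.
Context {R : realType} {Z W : Type} (C : calculus R Z W).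
Implicit Types (f g : Z -> R) (u w : W) (z : Z).
Notation A := (region C).
Notation smooth := (smooth C).
Notation D := (diff C).

Lemma smoothN f : smooth f -> smooth (fun z => - f z).
Proof.
move=> sf; apply: smooth_eq (smoothM (smooth_cst C (-1)) sf) => z _.
by rewrite mulN1r.
Qed.

Lemma smoothB f g : smooth f -> smooth g -> smooth (fun z => f z - g z).
Proof. by move=> sf sg; apply: smoothD sf (smoothN sg). Qed.

Lemma smooth_sum (I : Type) (r : seq I) (P : pred I) (F : I -> Z -> R) :
  (forall i, smooth (F i)) -> smooth (fun z => \sum_(i <- r | P i) F i z).
Proof.
move=> sF; elim: r => [|i r IH].
  by apply: smooth_eq (smooth_cst C 0) => z _; rewrite big_nil.
have [Pi|nPi] := boolP (P i).
  by apply: smooth_eq (smoothD (sF i) IH) => z _; rewrite big_cons Pi.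
by apply: smooth_eq IH => z _; rewrite big_cons (negPf nPi).
Qed.

Section Differentiation.
Variables (u : W) (z : Z).
Hypothesis Az : A z.

Lemma diffZ (r : R) f : smooth f -> D u (fun y => r * f y) z = r * D u f z.
Proof.
by move=> sf; rewrite diffM ?diff_cst ?mul0r ?add0r//; apply: smooth_cst.
Qed.

Lemma diffN f : smooth f -> D u (fun y => - f y) z = - D u f z.
Proof.
move=> sf; rewrite -mulN1r -diffZ//.
by apply: diff_eq => // y _; rewrite mulN1r.
Qed.

Lemma diffB f g : smooth f -> smooth g ->
  D u (fun y => f y - g y) z = D u f z - D u g z.
Proof. by move=> sf sg; rewrite diffD ?diffN//; apply: smoothN. Qed.

Lemma diff_sum (I : Type) (r : seq I) (P : pred I) (F : I -> Z -> R) :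
  (forall i, smooth (F i)) ->
  D u (fun y => \sum_(i <- r | P i) F i y) z = \sum_(i <- r | P i) D u (F i) z.
Proof.
move=> sF; elim: r => [|i r IH].
  by under eq_fun do rewrite big_nil; rewrite big_nil diff_cst.
under eq_fun do rewrite big_cons; rewrite big_cons -IH; case: (P i) => //.
by rewrite diffD//; apply: smooth_sum.
Qed.

End Differentiation.

Section VectorFields.
Context {I J : finType} (e : I -> J -> W).
Implicit Types (a b : I -> J -> Z -> R).

Definition field u a f z : R :=
  D u f z - \sum_c \sum_j a c j z * D (e c j) f z.

Lemma fieldE u a f z :
  field u a f z = D u f z - \sum_s a s.1 s.2 z * D (e s.1 s.2) f z.
Proof. by rewrite /field pair_bigA. Qed.

Lemma smooth_field u a f : (forall c j, smooth (a c j)) -> smooth f ->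
  smooth (field u a f).
Proof.
move=> sa sf; apply: smoothB; first exact: smooth_diff.
apply: smooth_sum => c; apply: smooth_sum => j.
by apply: smoothM => //; apply: smooth_diff.
Qed.

Section Derivation.
Variables (u : W) (a : I -> J -> Z -> R) (z : Z).
Hypothesis Az : A z.

Lemma field_eq f g : (forall y, A y -> f y = g y) ->
  field u a f z = field u a g z.
Proof.
move=> fg; rewrite !fieldE (diff_eq _ fg)//; congr (_ - _).
by apply: eq_bigr => s _; rewrite (diff_eq _ fg).
Qed.

(** At a fixed point a field is a linear combination of the derivatives D_v, so a linear relation
    between those passes to it. The scalars may be values at z, as in the product rule, where they
    are g z and f z. *)
Lemma field_lin f g h (r s : R) :
  (forall v, D v f z = r * D v g z + s * D v h z) ->
  field u a f z = r * field u a g z + s * field u a h z.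
Proof.
move=> E; rewrite !fieldE E !mulrBr !mulr_sumr addrACA -opprD -big_split/=.
by congr (_ - _); apply: eq_bigr => t _; rewrite E; ring.
Qed.

Lemma field_cst (r : R) : field u a (fun=> r) z = 0.
Proof.
by rewrite fieldE diff_cst big1 ?subr0// => s _; rewrite diff_cst mulr0.
Qed.

Lemma fieldD f g : smooth f -> smooth g ->
  field u a (fun y => f y + g y) z = field u a f z + field u a g z.
Proof.
move=> sf sg; rewrite (@field_lin _ f g 1 1) ?mul1r// => v.
by rewrite !mul1r diffD.
Qed.

Lemma fieldM f g : smooth f -> smooth g ->
  field u a (fun y => f y * g y) z = field u a f z * g z + f z * field u a g z.
Proof.
move=> sf sg; rewrite (@field_lin _ f g (g z) (f z)) 1?mulrC// => v.
by rewrite diffM// (mulrC (g z)).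
Qed.

Lemma fieldZ (r : R) f : smooth f -> field u a (fun y => r * f y) z = r * field u a f z.
Proof.
by move=> sf; rewrite fieldM ?field_cst ?mul0r ?add0r//; apply: smooth_cst.
Qed.

Lemma fieldN f : smooth f -> field u a (fun y => - f y) z = - field u a f z.
Proof.
move=> sf; rewrite (@field_lin _ f f (-1) 0) ?mulN1r ?mul0r ?addr0// => v.
by rewrite diffN// mulN1r mul0r addr0.
Qed.

Lemma fieldB f g : smooth f -> smooth g ->
  field u a (fun y => f y - g y) z = field u a f z - field u a g z.
Proof. by move=> sf sg; rewrite fieldD ?fieldN//; apply: smoothN. Qed.

Lemma field_sum (K : Type) (r : seq K) (P : pred K) (F : K -> Z -> R) :
  (forall i, smooth (F i)) ->
  field u a (fun y => \sum_(i <- r | P i) F i y) z =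
  \sum_(i <- r | P i) field u a (F i) z.
Proof.
move=> sF; elim: r => [|i r IH].
  by under eq_fun do rewrite big_nil; rewrite big_nil field_cst.
under eq_fun do rewrite big_cons; rewrite big_cons -IH; case: (P i) => //.
by rewrite fieldD//; apply: smooth_sum.
Qed.

End Derivation.

(** The second-order parts cancel by symmetry of second derivatives, so the commutator is vertical.
    Its components are the torsions when the two fields are adapted derivatives. *)
Lemma field_comm u w a b f z : (forall c j, smooth (a c j)) ->
  (forall c j, smooth (b c j)) -> smooth f -> A z ->
  field u a (field w b f) z - field w b (field u a f) z =
  - \sum_c \sum_j (field u a (b c j) z - field w b (a c j) z) * D (e c j) f z.
Proof.
move=> sa sb sf Az.
(* Of the five terms, exchanging (u, a) with (w, b) fixes the first and the last, swaps the second
   with the fourth, and changes only the third; this one is what the commutator retains. *)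
have step u' w' a' b' : (forall c j, smooth (b' c j)) ->
    field u' a' (field w' b' f) z =
    D u' (D w' f) z - \sum_s a' s.1 s.2 z * D w' (D (e s.1 s.2) f) z
    - (\sum_s field u' a' (b' s.1 s.2) z * D (e s.1 s.2) f z)
    - (\sum_s b' s.1 s.2 z * D u' (D (e s.1 s.2) f) z)
    + \sum_s \sum_t a' s.1 s.2 z * b' t.1 t.2 z * D (e s.1 s.2) (D (e t.1 t.2) f) z.
  move=> sb'.
  have sbf s : smooth (fun y => b' s.1 s.2 y * D (e s.1 s.2) f y).
    by apply: smoothM => //; apply: smooth_diff.
  rewrite [X in field _ _ X](_ : _ = fun y =>
    D w' f y - \sum_s b' s.1 s.2 y * D (e s.1 s.2) f y); last first.
    by apply/funext => y; rewrite fieldE.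
  rewrite fieldB//; [|exact: smooth_diff|exact: smooth_sum].
  rewrite field_sum//.
  have -> : \sum_s field u' a' (fun y => b' s.1 s.2 y * D (e s.1 s.2) f y) z =
      \sum_s field u' a' (b' s.1 s.2) z * D (e s.1 s.2) f z
      + \sum_s b' s.1 s.2 z * D u' (D (e s.1 s.2) f) z
      - \sum_s \sum_t a' t.1 t.2 z * b' s.1 s.2 z * D (e t.1 t.2) (D (e s.1 s.2) f) z.
    rewrite -big_split -sumrB; apply: eq_bigr => s _ /=.
    rewrite fieldM//; last exact: smooth_diff.
    rewrite -addrA; congr (_ + _); rewrite fieldE mulrBr mulr_sumr; congr (_ - _).
    by apply: eq_bigr => t _; ring.
  rewrite [X in _ - (_ - X)]exchange_big/= fieldE.
  under [X in _ - X - _ = _]eq_bigr do rewrite diff_comm//.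
  ring.
rewrite pair_bigA/= (step _ _ _ _ sb) (step _ _ _ _ sa) (diff_comm w u sf Az).
have -> : \sum_s \sum_t b s.1 s.2 z * a t.1 t.2 z * D (e s.1 s.2) (D (e t.1 t.2) f) z =
  \sum_s \sum_t a s.1 s.2 z * b t.1 t.2 z * D (e s.1 s.2) (D (e t.1 t.2) f) z.
  rewrite exchange_big; apply: eq_bigr => s _; apply: eq_bigr => t _ /=.
  by rewrite diff_comm// (mulrC (b _ _ _)).
under [in RHS]eq_bigr do rewrite mulrBl.
rewrite sumrB; ring.
Qed.

(** A plain derivative D_u is the field with zero coefficients, so this is a case of [field_comm].
    It serves to move a vertical derivative past a horizontal one. *)
Lemma diff_field_comm u w b f z : (forall c j, smooth (b c j)) -> smooth f -> A z ->
  D u (field w b f) z =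
  field w b (D u f) z - \sum_c \sum_j D u (b c j) z * D (e c j) f z.
Proof.
move=> sb sf Az.
pose a0 (_ : I) (_ : J) (_ : Z) : R := 0.
have field0 g : field u a0 g = D u g.
  by apply/funext => y; rewrite fieldE big1 ?subr0// => s _; rewrite mul0r.
have sa0 c j : smooth (a0 c j) := smooth_cst C 0.
have := field_comm u w sa0 sb sf Az.
rewrite !field0 => /eqP; rewrite subr_eq addrC => /eqP ->; congr (_ - _).
apply: eq_bigr => c _; apply: eq_bigr => j _.
by rewrite field0 [X in _ - X]field_cst subr0.
Qed.

End VectorFields.

End CalculusTheory.

(** * Maxwell equations for arbitrary connection coefficients *)

Section MaxwellEquations.
Context {R : realType} {Z W : Type} (C : calculus R Z W) {p n : nat}.
Notation A := (region C).
Notation smooth := (smooth C).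
Variables (ut : 'I_p -> W) (ux : 'I_n -> W) (e : 'I_p -> 'I_n -> W).
Notation dx i := (diff C (ux i)).
Notation dv c i := (diff C (e c i)).
(* [M b c j] is M^(j)_(b)c and [N b i j] is N^(i)_(b)j, as in [Mconn] and [nconn] *)
Variables (M : 'I_p -> 'I_p -> 'I_n -> Z -> R) (N : 'I_p -> 'I_n -> 'I_n -> Z -> R).
Variables (H : 'I_p -> 'I_p -> 'I_p -> Z -> R) (G : 'I_n -> 'I_n -> 'I_p -> Z -> R)
  (L : 'I_n -> 'I_n -> 'I_n -> Z -> R) (V : 'I_n -> 'I_p -> 'I_n -> 'I_n -> Z -> R)
  (x : 'I_p -> 'I_n -> Z -> R).

Definition tfield c := field C e (ut c) (fun b j => M b c j).
Definition xfield i := field C e (ux i) (fun b j => N b j i).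

(** The deflection tensors for arbitrary coefficient functions and an arbitrary covector family x:
    the identities of this section come from commutators and the symmetry of [L], together with the
    extra symmetries stated in the vertical one, and not from the Cartan formulas. *)
Definition tdefl a i b z :=
  tfield b (x a i) z + (\sum_m H a m b z * x m i z) - \sum_m G m i b z * x a m z.
Definition xdefl a i j z := xfield j (x a i) z - \sum_m L m i j z * x a m z.
Definition vdefl a i c k z := dv c k (x a i) z - \sum_m V m c i k z * x a m z.
Definition em a i j z := 2^-1 * (xdefl a i j z - xdefl a j i z).

Hypothesis smooth_M : forall b c j, smooth (M b c j).
Hypothesis smooth_N : forall b i j, smooth (N b i j).
Hypothesis smooth_H : forall a b c, smooth (H a b c).
Hypothesis smooth_G : forall i j c, smooth (G i j c).
Hypothesis smooth_x : forall a i, smooth (x a i).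
Hypothesis L_sym : forall i j k z, A z -> L i j k z = L i k j z.

Lemma smooth_tfield c f : smooth f -> smooth (tfield c f).
Proof. by move=> sf; apply: smooth_field. Qed.

Lemma smooth_xfield i f : smooth f -> smooth (xfield i f).
Proof. by move=> sf; apply: smooth_field. Qed.

Lemma emE a i j z : A z ->
  em a i j z = 2^-1 * (xfield j (x a i) z - xfield i (x a j) z).
Proof.
move=> Az; rewrite /em /xdefl; congr (_ * _).
have -> : \sum_m L m j i z * x a m z = \sum_m L m i j z * x a m z.
  by apply: eq_bigr => m _; rewrite L_sym.
ring.
Qed.

Lemma tfield_em b a i k z : A z ->
  tfield b (em a i k) z =
  2^-1 * (tfield b (xfield k (x a i)) z - tfield b (xfield i (x a k)) z).
Proof.
move=> Az; have sx i' j' : smooth (xfield j' (x a i')) by apply: smooth_xfield.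
rewrite /tfield (field_eq _ _ _ Az (fun y Ay => emE a i k Ay)).
rewrite (fieldZ _ _ _ Az _ (smoothB (sx i k) (sx k i))).
by rewrite (fieldB _ _ _ Az (sx i k) (sx k i)).
Qed.

Section TimeEquation.
Variables (Rt : 'I_n -> 'I_p -> 'I_p -> 'I_n -> Z -> R) (z : Z).
Hypothesis Az : A z.
Hypothesis xfield_H : forall a b c k, xfield k (H a b c) z = 0.
Hypothesis RtE : forall m mu b k,
  Rt m mu b k z = xfield k (M mu b m) z - tfield b (N mu m k) z.

Lemma tfield_xfield b k f : smooth f ->
  tfield b (xfield k f) z =
  xfield k (tfield b f) z + \sum_m \sum_mu dv mu m f z * Rt m mu b k z.
Proof.
move=> sf; apply/eqP; rewrite addrC -subr_eq; apply/eqP.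
rewrite /tfield /xfield field_comm// exchange_big/= -sumrN.
apply: eq_bigr => m _; rewrite -sumrN; apply: eq_bigr => mu _.
by rewrite RtE /tfield /xfield; ring.
Qed.

Lemma maxwell_time a b i k :
  tfield b (em a i k) z + (\sum_m H a m b z * em m i k z)
  - (\sum_m G m i b z * em a m k z) - \sum_m G m k b z * em a i m z =
  2^-1 * alternate (fun i k =>
    xfield k (tdefl a i b) z - (\sum_m L m i k z * tdefl a m b z)
    + (\sum_m xdefl a i m z * (- G m k b z))
    + (\sum_m \sum_mu vdefl a i mu m z * Rt m mu b k z)
    - \sum_r (xfield k (fun y => - G r i b y) z
              + (\sum_m L r m k z * (- G m i b z))
              - (\sum_m L m i k z * (- G r m b z))
              + \sum_m \sum_mu V r mu k m z * Rt m mu b i z) * x a r z) i k.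
Proof.
rewrite tfield_em// /alternate.
pose P i k := \sum_m \sum_mu dv mu m (x a i) z * Rt m mu b k z.
pose Hs i k := \sum_m H a m b z * xfield k (x m i) z.
pose Ws i k := \sum_m xfield k (G m i b) z * x a m z.
pose S1 i k := \sum_m G m i b z * xfield k (x a m) z.
pose S2 i k := \sum_m G m i b z * xfield m (x a k) z.
pose Q i k := \sum_m G m i b z * \sum_r L r m k z * x a r z.
pose LD i k := \sum_m L m i k z * tdefl a m b z.
pose LG i k := \sum_r (\sum_m L m i k z * G r m b z) * x a r z.
pose VR i k := \sum_r (\sum_m \sum_mu V r mu i m z * Rt m mu b k z) * x a r z.
have LDsym i' k' : LD i' k' = LD k' i'.
  by apply: eq_bigr => m _; rewrite L_sym.
have LGsym i' k' : LG i' k' = LG k' i'.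
  by apply: eq_bigr => m _; congr (_ * _); apply: eq_bigr => r _; rewrite L_sym.
have EH i' k' : \sum_m H a m b z * em m i' k' z = 2^-1 * (Hs i' k' - Hs k' i').
  rewrite /Hs -sumrB mulr_sumr; apply: eq_bigr => m _; rewrite emE//; ring.
have EG1 i' k' : \sum_m G m i' b z * em a m k' z = 2^-1 * (S1 i' k' - S2 i' k').
  rewrite /S1 /S2 -sumrB mulr_sumr; apply: eq_bigr => m _; rewrite emE//; ring.
have EG2 : \sum_m G m k b z * em a i m z = 2^-1 * (S2 k i - S1 k i).
  rewrite /S1 /S2 -sumrB mulr_sumr; apply: eq_bigr => m _; rewrite emE//; ring.
have ED i' k' : xfield k' (tdefl a i' b) z =
    xfield k' (tfield b (x a i')) z + Hs i' k' - Ws i' k' - S1 i' k'.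
  have sHx m : smooth (fun y => H a m b y * x m i' y) by apply: smoothM.
  have sGx m : smooth (fun y => G m i' b y * x a m y) by apply: smoothM.
  have sT : smooth (tfield b (x a i')) by apply: smooth_tfield.
  rewrite /xfield fieldB//; last exact: smooth_sum; last first.
    by apply: smoothD => //; apply: smooth_sum.
  rewrite fieldD//; last exact: smooth_sum.
  rewrite !field_sum//.
  have -> : \sum_m field C e (ux k') (fun b0 j => N b0 j k')
      (fun y => H a m b y * x m i' y) z
      = Hs i' k'.
    by apply: eq_bigr => m _;
      rewrite fieldM//; rewrite -/(xfield _ _ _) xfield_H mul0r add0r.
  have -> : \sum_m field C e (ux k') (fun b0 j => N b0 j k')
      (fun y => G m i' b y * x a m y) z
      = Ws i' k' + S1 i' k'.
    by rewrite -big_split; apply: eq_bigr => m _; rewrite fieldM.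
  by rewrite opprD addrA.
have EX i' k' : \sum_m xdefl a i' m z * (- G m k' b z) = Q k' i' - S2 k' i'.
  rewrite /Q /S2 -sumrB; apply: eq_bigr => m _.
  rewrite /xdefl.
  have -> : \sum_r L r m i' z * x a r z = \sum_r L r i' m z * x a r z.
    by apply: eq_bigr => r _; rewrite L_sym.
  ring.
have EV i' k' : \sum_m \sum_mu vdefl a i' mu m z * Rt m mu b k' z = P i' k' - VR i' k'.
  rewrite /VR.
  under [X in _ - X]eq_bigr do rewrite mulr_suml.
  rewrite [X in _ - X]exchange_big -sumrB; apply: eq_bigr => m _ /=.
  under [X in _ - X]eq_bigr do rewrite mulr_suml.
  rewrite [X in _ - X]exchange_big -sumrB; apply: eq_bigr => mu _ /=.
  rewrite /vdefl mulrBl mulr_suml; congr (_ - _).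
  by apply: eq_bigr => r _; ring.
have EQ i' k' : \sum_r (xfield k' (fun y => - G r i' b y) z
              + (\sum_m L r m k' z * (- G m i' b z))
              - (\sum_m L m i' k' z * (- G r m b z))
              + \sum_m \sum_mu V r mu k' m z * Rt m mu b i' z) * x a r z =
    - Ws i' k' - Q i' k' + LG i' k' + VR k' i'.
  have -> : Q i' k' = \sum_r (\sum_m L r m k' z * G m i' b z) * x a r z.
    rewrite /Q; under eq_bigr do rewrite mulr_sumr.
    rewrite exchange_big; apply: eq_bigr => r _; rewrite mulr_suml.
    by apply: eq_bigr => m _; ring.
  rewrite /Ws /LG /VR -!sumrN -!big_split; apply: eq_bigr => r _ /=.
  have -> : xfield k' (fun y => - G r i' b y) z = - xfield k' (G r i' b) z.
    exact: fieldN.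
  have -> : \sum_m L r m k' z * (- G m i' b z) = - \sum_m L r m k' z * G m i' b z.
    by rewrite -sumrN; apply: eq_bigr => m _; rewrite mulrN.
  have -> : \sum_m L m i' k' z * (- G r m b z) = - \sum_m L m i' k' z * G r m b z.
    by rewrite -sumrN; apply: eq_bigr => m _; rewrite mulrN.
  ring.
rewrite !tfield_xfield// -/(P i k) -/(P k i).
rewrite EH EG1 EG2 !ED !EX !EV !EQ -/(LD i k) -/(LD k i) (LDsym k i) (LGsym k i).
ring.
Qed.

End TimeEquation.

Section SpaceEquations.

Lemma maxwell_space a i j k z : A z ->
  cyclic (fun i j k => xfield k (em a i j) z - (\sum_m L m i k z * em a m j z)
    - \sum_m L m j k z * em a i m z) i j k =
  - 2^-1 * cyclic (fun i j k => \sum_m \sum_mu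
     (xfield k (N mu m j) z - xfield j (N mu m k) z) * dv mu m (x a i) z) i j k.
Proof.
move=> Az; have sx i' j' : smooth (xfield j' (x a i')) by apply: smooth_xfield.
have Ex i' j' k' : xfield k' (em a i' j') z =
    2^-1 * (xfield k' (xfield j' (x a i')) z - xfield k' (xfield i' (x a j')) z).
  rewrite /xfield (field_eq _ _ _ Az (fun y Ay => emE a i' j' Ay)).
  rewrite (fieldZ _ _ _ Az _ (smoothB (sx i' j') (sx j' i'))).
  by rewrite (fieldB _ _ _ Az (sx i' j') (sx j' i')).
have Ec i' j' k' : \sum_m \sum_mu (xfield k' (N mu m j') z - xfield j' (N mu m k') z)
      * dv mu m (x a i') z =
    xfield j' (xfield k' (x a i')) z - xfield k' (xfield j' (x a i')) z.
  rewrite -opprB /xfield field_comm// opprK exchange_big.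
  by apply: eq_bigr => m _; apply: eq_bigr => mu _.
(* Since [em] is antisymmetric, the first L correction of each cyclic term cancels the second
   correction of the next one. *)
have EL i' j' k' : \sum_m L m i' k' z * em a m j' z = - \sum_m L m k' i' z * em a j' m z.
  rewrite -sumrN; apply: eq_bigr => m _; rewrite L_sym// !emE//; ring.
rewrite /cyclic !Ex !Ec !EL; ring.
Qed.

(** Moved inside, the vertical derivative leaves a term symmetric in i and k by [x_sym], and the
    correction [B], symmetric in its last two indices by [N_sym]. Antisymmetrized as in [em], both
    have zero cyclic sum; the V corrections cancel like the L corrections of [maxwell_space]. *)
Lemma maxwell_vertical a c i j k z : A z ->
  (forall i j y, A y -> dv c j (x a i) y = dv c i (x a j) y) ->
  (forall b m j k, dv c k (N b m j) z = dv c j (N b m k) z) ->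
  (forall m i k, V m c i k z = V m c k i z) ->
  cyclic (fun i j k => dv c k (em a i j) z - (\sum_m V m c i k z * em a m j z)
    - \sum_m V m c j k z * em a i m z) i j k = 0.
Proof.
move=> Az x_sym N_sym V_sym.
have sx i' j' : smooth (xfield j' (x a i')) by apply: smooth_xfield.
pose B i' j' k' := \sum_b \sum_m dv c k' (N b m j') z * dv b m (x a i') z.
have Bsym i' j' k' : B i' j' k' = B i' k' j'.
  by apply: eq_bigr => b _; apply: eq_bigr => m _; rewrite N_sym.
have Ex i' j' k' : dv c k' (em a i' j') z =
    2^-1 * (xfield j' (dv c k' (x a i')) z - B i' j' k'
            - (xfield i' (dv c k' (x a j')) z - B j' i' k')).
  rewrite (diff_eq _ (fun y Ay => emE a i' j' Ay))//.
  rewrite (diffZ _ Az _ (smoothB (sx i' j') (sx j' i'))).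
  by rewrite (diffB _ Az (sx i' j') (sx j' i')) /xfield !diff_field_comm.
have Exs i' j' k' : xfield j' (dv c k' (x a i')) z = xfield j' (dv c i' (x a k')) z.
  by rewrite /xfield (field_eq _ _ _ Az (fun y Ay => x_sym i' k' y Ay)).
have EV i' j' k' : \sum_m V m c i' k' z * em a m j' z = - \sum_m V m c k' i' z * em a j' m z.
  rewrite -sumrN; apply: eq_bigr => m _; rewrite V_sym// !emE//; ring.
rewrite /cyclic !Ex !EV (Exs k j i) (Exs j i k) (Exs i k j).
rewrite (Bsym i k j) (Bsym j k i) (Bsym k j i).
ring.
Qed.

End SpaceEquations.

End MaxwellEquations.

(** * Mixed torsion, lowered velocity and the cyclic curvature identity *)

Section Lagrangian.
Context {R : realType} {Z W : Type} (C : calculus R Z W) {p n : nat}.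
Notation A := (region C).
Notation smooth := (smooth C).
Variables (ut : 'I_p -> W) (ux : 'I_n -> W) (e : 'I_p -> 'I_n -> W).
Notation dt c := (diff C (ut c)).
Notation dx i := (diff C (ux i)).
Notation dv c i := (diff C (e c i)).
Variables (y : 'I_p -> 'I_n -> Z -> R).
Hypothesis smooth_y : forall a i, smooth (y a i).
Hypothesis dv_y : forall c k a i z, dv c k (y a i) z = ((c == a) && (k == i))%:R.
Hypothesis dx_y : forall k a i z, dx k (y a i) z = 0.

Lemma sum_dv_y (f : 'I_p -> 'I_n -> R) a i z :
  \sum_c \sum_k f c k * dv c k (y a i) z = f a i.
Proof.
rewrite (bigD1 a)//= (bigD1 i)//= dv_y !eqxx mulr1 !big1 ?addr0// => [c ca|k ki].
  by rewrite big1// => k _; rewrite dv_y (negPf ca) mulr0.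
by rewrite dv_y (negPf ki) andbF mulr0.
Qed.

Section Torsion.
Variables (H : 'I_p -> 'I_p -> 'I_p -> Z -> R) (M : 'I_p -> 'I_p -> 'I_n -> Z -> R)
  (N : 'I_p -> 'I_n -> 'I_n -> Z -> R).
Hypothesis smooth_H : forall a b c, smooth (H a b c).
Hypothesis dx_H : forall a b c k z, dx k (H a b c) z = 0.
Hypothesis dv_H : forall a b c d k z, dv d k (H a b c) z = 0.
Hypothesis M_def : forall a b i z, M a b i z = - \sum_c H c a b z * y c i z.

Lemma xfield_H a b c k z : xfield C ux e N k (H a b c) z = 0.
Proof.
rewrite /xfield fieldE dx_H big1 ?subr0// => s _; by rewrite dv_H mulr0.
Qed.

(** A closed form of the mixed torsion common to all p, against which [Rt1] and [Rt_multi] are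
    checked separately. *)
Lemma torsion_time m mu b k z : A z ->
  xfield C ux e N k (M mu b m) z - tfield C ut e M b (N mu m k) z =
  - dt b (N mu m k) z + \sum_c H c mu b z * N c m k z
  - \sum_nu \sum_j (\sum_c H c nu b z * y c j z) * dv nu j (N mu m k) z.
Proof.
move=> Az.
have -> : xfield C ux e N k (M mu b m) z = \sum_c H c mu b z * N c m k z.
  have sHy c : smooth (fun z => H c mu b z * y c m z) by apply: smoothM.
  rewrite /xfield (field_eq _ _ _ Az (fun w _ => M_def mu b m w)).
  rewrite fieldN//; last exact: smooth_sum.
  rewrite field_sum// -sumrN; apply: eq_bigr => c _.
  rewrite (fieldM _ _ _ Az (smooth_H c mu b) (smooth_y c m)).
  rewrite -!/(xfield _ _ _ _ k _ _) xfield_H mul0r add0r /xfield /field dx_y sub0r.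
  by rewrite (sum_dv_y (fun b i => N b i k z)) mulrN opprK.
have E : \sum_nu \sum_j M nu b j z * dv nu j (N mu m k) z =
    - \sum_nu \sum_j (\sum_c H c nu b z * y c j z) * dv nu j (N mu m k) z.
  rewrite -sumrN; apply: eq_bigr => nu _; rewrite -sumrN.
  by apply: eq_bigr => j _; rewrite M_def mulNr.
rewrite /tfield /field E; ring.
Qed.

End Torsion.

Section LoweredVelocity.
Variable Lg : Z -> R.
Hypothesis smooth_Lg : smooth Lg.

(** Written so that in the coordinate calculus [vhess] and [vlow] are convertible to [Gvert] and
    [xlow]. *)
Definition vhess a i b j z := 2^-1 * dv a i (dv b j Lg) z.
Definition vlow a i z := \sum_c \sum_k vhess a i c k z * y c k z.
Definition vthird a i b j c k z := 2^-1 * dv a i (dv b j (dv c k Lg)) z.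

Lemma smooth_vhess a i b j : smooth (vhess a i b j).
Proof.
by apply: smoothM; [exact: smooth_cst|do 2 apply: smooth_diff].
Qed.

Lemma vthird_rotate a i b j c k z : A z ->
  vthird a i b j c k z = vthird c k a i b j z.
Proof.
move=> Az; rewrite /vthird; congr (_ * _).
transitivity (dv a i (dv c k (dv b j Lg)) z).
  by apply: diff_eq => // w Aw; apply: diff_comm.
by rewrite diff_comm//; apply: smooth_diff.
Qed.

Lemma smooth_vlow a i : smooth (vlow a i).
Proof.
apply: smooth_sum => c; apply: smooth_sum => k.
by apply: smoothM => //; apply: smooth_vhess.
Qed.

Lemma dv_vhess d l a i c k z : A z -> dv d l (vhess a i c k) z = vthird d l a i c k z.
Proof. by move=> Az; rewrite diffZ//; do 2 apply: smooth_diff. Qed.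

Lemma dv_vlow mu m a i z : A z -> dv mu m (vlow a i) z =
  vhess mu m a i z + \sum_c \sum_k vthird mu m a i c k z * y c k z.
Proof.
move=> Az; have sh c k : smooth (fun z => vhess a i c k z * y c k z).
  by apply: smoothM => //; apply: smooth_vhess.
rewrite diff_sum//; last by move=> c; apply: smooth_sum.
transitivity (\sum_c \sum_k (vhess a i c k z * dv mu m (y c k) z
    + vthird mu m a i c k z * y c k z)).
  apply: eq_bigr => c _; rewrite diff_sum//; apply: eq_bigr => k _.
  by rewrite diffM// ?dv_vhess 1?addrC//; apply: smooth_vhess.
under eq_bigr do rewrite big_split/=.
rewrite big_split/=; congr (_ + _).
rewrite (bigD1 mu)//= (bigD1 m)//= dv_y !eqxx mulr1 !big1 ?addr0//.
- by rewrite /vhess diff_comm.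
- by move=> c cm; rewrite big1// => k _; rewrite dv_y (eq_sym mu) (negPf cm) mulr0.
- by move=> k km; rewrite dv_y (eq_sym m) (negPf km) andbF mulr0.
Qed.

Variable N : 'I_p -> 'I_n -> 'I_n -> Z -> R.
Hypothesis smooth_N : forall b i j, smooth (N b i j).
Let Rx m mu j k z :=
  xfield C ux e N k (N mu m j) z - xfield C ux e N j (N mu m k) z.

(* The horizontal distribution is Lagrangian for the closed 2-form
   d(dL/dv^i_a dx^i), hence the Bianchi-type identity below. *)
Hypothesis horizontal_lagrangian : forall a i j z, A z ->
  xfield C ux e N j (dv a i Lg) z = xfield C ux e N i (dv a j Lg) z.

(** The contraction of the curvature with the vertical Hessian is half a commutator of horizontal
    derivatives applied to dL/dv^i. By the symmetry of the inner derivative the six second-order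
    terms cancel in pairs, as in d d = 0. *)
Lemma cyclic_curvature a i j k z : A z ->
  cyclic (fun i j k => \sum_m \sum_mu Rx m mu j k z * vhess mu m a i z) i j k = 0.
Proof.
move=> Az.
have sL a' i' : smooth (dv a' i' Lg) by apply: smooth_diff.
have E i' j' k' : \sum_m \sum_mu Rx m mu j' k' z * vhess mu m a i' z =
    2^-1 * (xfield C ux e N j' (xfield C ux e N k' (dv a i' Lg)) z
            - xfield C ux e N k' (xfield C ux e N j' (dv a i' Lg)) z).
  rewrite -opprB {2 3}/xfield field_comm// opprK exchange_big mulr_sumr.
  apply: eq_bigr => m _; rewrite mulr_sumr; apply: eq_bigr => mu _.
  by rewrite /Rx /vhess /xfield; ring.
have S i' j' k' : xfield C ux e N k' (xfield C ux e N j' (dv a i' Lg)) z =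
    xfield C ux e N k' (xfield C ux e N i' (dv a j' Lg)) z.
  by rewrite {1 3}/xfield; apply: field_eq => // w Aw; apply: horizontal_lagrangian.
rewrite /cyclic !E (S i j k) (S j k i) (S k i j); ring.
Qed.

Lemma cyclic_curvature_vlow a i j k z : A z ->
  cyclic (fun i j k => \sum_m \sum_mu Rx m mu j k z * dv mu m (vlow a i) z) i j k =
  cyclic (fun i j k => \sum_m \sum_mu Rx m mu j k z *
    \sum_c \sum_l vthird mu m a i c l z * y c l z) i j k.
Proof.
move=> Az.
have E i' j' k' : \sum_m \sum_mu Rx m mu j' k' z * dv mu m (vlow a i') z =
    \sum_m \sum_mu Rx m mu j' k' z * vhess mu m a i' z
  + \sum_m \sum_mu Rx m mu j' k' z * \sum_c \sum_l vthird mu m a i' c l z * y c l z.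
  rewrite -big_split; apply: eq_bigr => m _; rewrite -big_split.
  by apply: eq_bigr => mu _; rewrite dv_vlow// mulrDr.
have := cyclic_curvature a i j k Az.
rewrite /cyclic !E => Z0.
by apply/eqP; rewrite -subr_eq0 -[X in _ == X]Z0; apply/eqP; ring.
Qed.

End LoweredVelocity.

End Lagrangian.

(** * The case p = 1: the semispray connection *)

Section SingleTime.
Context {R : realType} {Z W : Type} (C : calculus R Z W) {n : nat}.
Notation A := (region C).
Notation smooth := (smooth C).
Variables (ut : W) (ux : 'I_n -> W) (e : 'I_1 -> 'I_n -> W).
Notation dt := (diff C ut).
Notation dx i := (diff C (ux i)).
Notation dv i := (diff C (e ord0 i)).
Variables (y : 'I_n -> Z -> R) (h hi H L : Z -> R) (g gi : 'I_n -> 'I_n -> Z -> R).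
Hypothesis smooth_y : forall i, smooth (y i).
Hypothesis smooth_h : smooth h.
Hypothesis smooth_hi : smooth hi.
Hypothesis smooth_H : smooth H.
Hypothesis smooth_L : smooth L.
Hypothesis smooth_g : forall i j, smooth (g i j).
Hypothesis smooth_gi : forall i j, smooth (gi i j).
Hypothesis dv_y : forall k i z, dv k (y i) z = (k == i)%:R.
Hypothesis dv_h : forall k z, dv k h z = 0.
Hypothesis dv_hi : forall k z, dv k hi z = 0.
Hypothesis dv_H : forall k z, dv k H z = 0.
Hypothesis h_hi : forall z, A z -> h z * hi z = 1.
Hypothesis g_sym : forall i j z, A z -> g i j z = g j i z.
Hypothesis g_gi : forall i k z, A z -> \sum_m g i m z * gi m k z = (i == k)%:R.
Hypothesis kronecker : forall i j z, A z ->
  2^-1 * dv i (dv j L) z = hi z * g i j z.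

(** The bracket in the definition of the semispray; it is 4 times the semispray with its index
    lowered by g ([spray_coef_low]). *)
Definition spray_form k z :=
  (\sum_j dx j (dv k L) z * y j z) - dx k L z + dt (dv k L) z + dv k L z * H z
  + 2 * hi z * H z * \sum_l g k l z * y l z.
Definition spray_coef i z := \sum_k gi i k z / 4 * spray_form k z.
Definition spray_conn (b : 'I_1) i j z := h z * dv j (spray_coef i) z.

Lemma smooth_spray_form k : smooth (spray_form k).
Proof.
have sL k' : smooth (dv k' L) by apply: smooth_diff.
have s1 : smooth (fun z => \sum_j dx j (dv k L) z * y j z).
  by apply: smooth_sum => j; apply: smoothM => //; apply: smooth_diff.
have s2 : smooth (fun z => \sum_l g k l z * y l z).
  by apply: smooth_sum => j; apply: smoothM.
apply: smoothD; last first.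
  by apply: smoothM => //; apply: smoothM => //; apply: smoothM => //; apply: smooth_cst.
apply: smoothD; last exact: smoothM.
apply: smoothD; last exact: smooth_diff.
by apply: smoothB => //; apply: smooth_diff.
Qed.

Lemma smooth_spray_coef i : smooth (spray_coef i).
Proof.
apply: smooth_sum => k; apply: smoothM; last exact: smooth_spray_form.
by apply: smoothM => //; apply: smooth_cst.
Qed.

Lemma smooth_spray_conn b i j : smooth (spray_conn b i j).
Proof. by apply: smoothM => //; apply: smooth_diff; apply: smooth_spray_coef. Qed.

Lemma spray_conn_sym b m j k z : A z ->
  dv k (spray_conn b m j) z = dv j (spray_conn b m k) z.
Proof.
move=> Az; have sS := smooth_spray_coef m.
have sdS i : smooth (dv i (spray_coef m)) by apply: smooth_diff.
by rewrite !diffM// !dv_h !mul0r !add0r diff_comm.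
Qed.

(** By Kronecker regularity h^11 g_ij is half a second vertical derivative of L, and h^11 is
    constant along the fibres and nonzero; so the vertical derivative of g inherits the symmetry of
    the third derivatives of L. *)
Lemma dv_g_sym i j k z : A z -> dv k (g i j) z = dv j (g i k) z.
Proof.
move=> Az.
have hi0 : hi z != 0.
  by apply/eqP => hi0; have /eqP := h_hi Az; rewrite hi0 mulr0 eq_sym oner_eq0.
have E k' j' : hi z * dv k' (g i j') z = 2^-1 * dv k' (dv i (dv j' L)) z.
  rewrite -[RHS]diffZ//; last by do 2 apply: smooth_diff.
  rewrite (diff_eq _ (fun w Aw => kronecker i j' Aw))// diffM//.
  by rewrite dv_hi mul0r add0r.
apply: (mulfI hi0); rewrite !E; congr (_ * _).
have sL k' : smooth (dv k' L) by apply: smooth_diff.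
have swap a b : dv i (dv a (dv b L)) z = dv i (dv b (dv a L)) z.
  by apply: diff_eq => // w Aw; apply: diff_comm.
by rewrite (diff_comm _ _ (sL j) Az) swap (diff_comm _ _ (sL k) Az).
Qed.

Lemma g_sym_dv i j m z : A z -> dv i (g j m) z = dv j (g i m) z.
Proof.
move=> Az; rewrite dv_g_sym// (diff_eq _ (fun w Aw => g_sym j i Aw))//.
by rewrite dv_g_sym.
Qed.

Lemma spray_coef_low i z : A z ->
  \sum_m g i m z * spray_coef m z = 4^-1 * spray_form i z.
Proof.
move=> Az; under eq_bigr do rewrite mulr_sumr.
rewrite exchange_big/=.
transitivity (\sum_k (i == k)%:R * (4^-1 * spray_form k z)).
  apply: eq_bigr => k _; rewrite -(g_gi _ _ Az) mulr_suml; apply: eq_bigr => m _; ring.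
rewrite (bigD1 i)//= eqxx mul1r big1 ?addr0// => k ki.
by rewrite eq_sym (negPf ki) mul0r.
Qed.

(** Arranged so that only the final difference fails to be symmetric in i and j. Its first term
    comes from differentiating y^j, its second from - dL/dx^i. *)
Lemma dv_spray_form i j z : A z -> dv j (spray_form i) z =
  (\sum_k dx k (dv j (dv i L)) z * y k z) + dt (dv j (dv i L)) z
  + dv j (dv i L) z * H z
  + 2 * hi z * H z * (g i j z + \sum_l dv j (g i l) z * y l z)
  + (dx j (dv i L) z - dx i (dv j L) z).
Proof.
move=> Az; have sL k : smooth (dv k L) by apply: smooth_diff.
have sxL k : smooth (dx k (dv i L)) by apply: smooth_diff.
have sxy k : smooth (fun z => dx k (dv i L) z * y k z) by apply: smoothM.
have s1 : smooth (fun z => \sum_j dx j (dv i L) z * y j z) by apply: smooth_sum.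
have s2 : smooth (dx i L) by apply: smooth_diff.
have s3 : smooth (dt (dv i L)) by apply: smooth_diff.
have s4 : smooth (fun z => dv i L z * H z) by apply: smoothM.
have sgy l : smooth (fun z => g i l z * y l z) by apply: smoothM.
have s5 : smooth (fun z => \sum_l g i l z * y l z) by apply: smooth_sum.
have s6' : smooth (fun z => 2 * hi z) by apply: smoothM => //; apply: smooth_cst.
have s6 : smooth (fun z => 2 * hi z * H z) by apply: smoothM.
have s7 : smooth (fun z => 2 * hi z * H z * \sum_l g i l z * y l z).
  by apply: smoothM.
have s12 := smoothB s1 s2; have s123 := smoothD s12 s3; have s1234 := smoothD s123 s4.
rewrite /spray_form (diffD _ s1234 s7 Az) (diffD _ s123 s4 Az) (diffD _ s12 s3 Az).
rewrite (diffB _ Az s1 s2) (diffM _ (sL i) smooth_H Az) dv_H mulr0 addr0.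
rewrite (diffM _ s6 s5 Az) (diffM _ s6' smooth_H Az) (diffZ _ Az _ smooth_hi) dv_hi dv_H.
rewrite !(mulr0, mul0r, add0r, addr0).
rewrite (diff_sum _ Az _ _ sxy) (diff_sum _ Az _ _ sgy).
have -> : \sum_k dv j (fun z => dx k (dv i L) z * y k z) z =
    dx j (dv i L) z + \sum_k dx k (dv j (dv i L)) z * y k z.
  transitivity (\sum_k ((j == k)%:R * dx k (dv i L) z + dx k (dv j (dv i L)) z * y k z)).
    apply: eq_bigr => k _; rewrite diffM// dv_y diff_comm//; ring.
  rewrite big_split (bigD1 j)//= eqxx mul1r big1 ?addr0// => k kj.
  by rewrite eq_sym (negPf kj) mul0r.
have -> : \sum_l dv j (fun z => g i l z * y l z) z =
    g i j z + \sum_l dv j (g i l) z * y l z.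
  transitivity (\sum_l ((j == l)%:R * g i l z + dv j (g i l) z * y l z)).
    apply: eq_bigr => l _; rewrite diffM// dv_y; ring.
  rewrite big_split (bigD1 j)//= eqxx mul1r big1 ?addr0// => l lj.
  by rewrite eq_sym (negPf lj) mul0r.
rewrite (diff_comm (e ord0 j) (ux i) smooth_L Az) (diff_comm (e ord0 j) ut (sL i) Az).
ring.
Qed.

(** Differentiating [spray_coef_low] along v^j shows that N contracted with the Hessian of L is half
    of [dv j (spray_form i)] minus the symmetric [2 * Q i j]. By [dv_spray_form] its antisymmetric
    part is that of [dx j (dv i L)], so the difference of the two is symmetric. *)
Lemma spray_lagrangian i j z : A z ->
  xfield C ux e spray_conn j (dv i L) z = xfield C ux e spray_conn i (dv j L) z.
Proof.
move=> Az; have sL k : smooth (dv k L) by apply: smooth_diff.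
have sS m : smooth (spray_coef m) by apply: smooth_spray_coef.
have n4 : (4 : R) != 0 by rewrite pnatr_eq0.
pose Q i j := \sum_m dv j (g i m) z * spray_coef m z.
have Qsym : Q j i = Q i j by apply: eq_bigr => m _; rewrite g_sym_dv.
have T i' j' : \sum_b \sum_m spray_conn b m j' z * diff C (e b m) (dv i' L) z =
    2^-1 * dv j' (spray_form i') z - 2 * Q i' j'.
  have -> : dv j' (spray_form i') z =
      4 * \sum_m (dv j' (g i' m) z * spray_coef m z + g i' m z * dv j' (spray_coef m) z).
    have sgS m : smooth (fun z => g i' m z * spray_coef m z) by apply: smoothM.
    rewrite -[LHS](mulVKf n4) -diffZ//; last exact: smooth_spray_form.
    rewrite -(diff_eq _ (fun w Aw => spray_coef_low i' Aw))// diff_sum//.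
    by congr (_ * _); apply: eq_bigr => m _; rewrite diffM.
  rewrite big_ord1 big_split/= -/(Q i' j').
  have -> : \sum_m spray_conn ord0 m j' z * dv m (dv i' L) z =
      2 * \sum_m g i' m z * dv j' (spray_coef m) z.
    rewrite mulr_sumr; apply: eq_bigr => m _; rewrite /spray_conn.
    have -> : dv m (dv i' L) z = 2 * (hi z * g i' m z).
      by rewrite (g_sym i' m Az) -kronecker// mulVKf.
    transitivity (h z * hi z * (2 * (g i' m z * dv j' (spray_coef m) z))); first by ring.
    by rewrite h_hi// mul1r.
  by field.
rewrite /xfield /field !T Qsym !dv_spray_form//.
have -> : \sum_k dx k (dv i (dv j L)) z * y k z = \sum_k dx k (dv j (dv i L)) z * y k z.
  apply: eq_bigr => k _; congr (_ * _); apply: diff_eq => // w Aw; exact: diff_comm.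
have -> : dt (dv i (dv j L)) z = dt (dv j (dv i L)) z.
  by apply: diff_eq => // w Aw; apply: diff_comm.
have -> : \sum_l dv i (g j l) z * y l z = \sum_l dv j (g i l) z * y l z.
  by apply: eq_bigr => l _; rewrite g_sym_dv.
rewrite (diff_comm (e ord0 i) (e ord0 j) smooth_L Az) (g_sym j i Az); by field.
Qed.

(** The vertical derivative of g is totally symmetric, so the three terms in the Cartan coefficient
    reduce to one. The prefactor 1/2 of that coefficient then survives, which is the outer factor on
    the right. *)
Lemma lowered_cartan i l m z : A z ->
  \sum_q 2^-1 * dv l (dv q L) z * (\sum_s gi q s z / 2 *
     (dv m (g s i) z + dv i (g s m) z - dv s (g i m) z)) =
  2^-1 * (2^-1 * dv i (dv l (dv m L)) z).
Proof.
move=> Az; have sL k k' : smooth (dv k (dv k' L)) by do 2 apply: smooth_diff.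
have -> : 2^-1 * dv i (dv l (dv m L)) z = hi z * dv i (g l m) z.
  rewrite -[LHS](diffZ _ Az)// (diff_eq _ (fun w Aw => kronecker l m Aw))//.
  by rewrite diffM// dv_hi mul0r add0r.
pose B s := dv m (g s i) z + dv i (g s m) z - dv s (g i m) z.
have Bl : B l = dv i (g l m) z.
  rewrite /B (dv_g_sym l i m Az) addrAC -[RHS]add0r; congr (_ + _).
  by rewrite (g_sym_dv i l m Az) subrr.
transitivity (\sum_s (\sum_q g l q z * gi q s z) * (hi z * (2^-1 * B s))).
  under eq_bigr do rewrite mulr_sumr.
  rewrite exchange_big; apply: eq_bigr => s _; rewrite mulr_suml; apply: eq_bigr => q _.
  by rewrite kronecker// /B; ring.
rewrite (bigD1 l)//= g_gi// eqxx mul1r Bl big1 ?addr0; last first.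
  by move=> s sl; rewrite g_gi// eq_sym (negPf sl) mul0r.
by ring.
Qed.

End SingleTime.

(** The identity exchanges the spatial indices but not the temporal ones, so commuting derivatives
    proves it only for p = 1; [dv_vlow_sym_multi] relies on Kronecker regularity instead. *)
Lemma dv_vlow_sym_single (R : realType) (Z W : Type) (C : calculus R Z W) n
    (e : 'I_1 -> 'I_n -> W) (y : 'I_1 -> 'I_n -> Z -> R) (L : Z -> R) :
  (forall a i, smooth C (y a i)) ->
  (forall c k a i z, diff C (e c k) (y a i) z = ((c == a) && (k == i))%:R) ->
  smooth C L -> forall c a i k z, region C z ->
  diff C (e c k) (vlow C e y L a i) z = diff C (e c i) (vlow C e y L a k) z.
Proof.
move=> sy dy sL c a i k z Az; rewrite !dv_vlow//; congr (_ + _).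
  by rewrite /vhess (ord1 c) (ord1 a) diff_comm.
apply: eq_bigr => d _; apply: eq_bigr => l _; congr (_ * _).
rewrite /vthird (ord1 c) (ord1 a) diff_comm//; exact: smooth_diff.
Qed.

(** * The case p >= 2: velocity-independent metric and affine momenta *)

Section MultiTime.
Context {R : realType} {Z W : Type} (C : calculus R Z W) {p n : nat}.
Notation A := (region C).
Notation smooth := (smooth C).
Variables (ut : 'I_p -> W) (ux : 'I_n -> W) (e : 'I_p -> 'I_n -> W).
Notation dt c := (diff C (ut c)).
Notation dx i := (diff C (ux i)).
Notation dv c i := (diff C (e c i)).
Variables (y : 'I_p -> 'I_n -> Z -> R) (h hi : 'I_p -> 'I_p -> Z -> R)
  (g gi : 'I_n -> 'I_n -> Z -> R) (L : Z -> R) (U : 'I_p -> 'I_n -> Z -> R).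
Hypothesis p_gt1 : (1 < p)%N.
Hypothesis smooth_y : forall a i, smooth (y a i).
Hypothesis smooth_h : forall a b, smooth (h a b).
Hypothesis smooth_hi : forall a b, smooth (hi a b).
Hypothesis smooth_g : forall i j, smooth (g i j).
Hypothesis smooth_gi : forall i j, smooth (gi i j).
Hypothesis smooth_L : smooth L.
Hypothesis smooth_U : forall a i, smooth (U a i).
Hypothesis dv_y : forall c k a i z, dv c k (y a i) z = ((c == a) && (k == i))%:R.
Hypothesis dx_y : forall k a i z, dx k (y a i) z = 0.
Hypothesis dv_h : forall c k a b z, dv c k (h a b) z = 0.
Hypothesis dv_hi : forall c k a b z, dv c k (hi a b) z = 0.
Hypothesis dx_hi : forall k a b z, dx k (hi a b) z = 0.
Hypothesis hi_sym : forall a b z, A z -> hi a b z = hi b a z.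
Hypothesis hi_h : forall a c z, A z -> \sum_b hi a b z * h b c z = (a == c)%:R.
Hypothesis g_sym : forall i j z, A z -> g i j z = g j i z.
Hypothesis g_gi : forall i k z, A z -> \sum_m g i m z * gi m k z = (i == k)%:R.
Hypothesis gi_g : forall i k z, A z -> \sum_m gi i m z * g m k z = (i == k)%:R.
Hypothesis kronecker : forall a b i j z, A z ->
  2^-1 * dv a i (dv b j L) z = hi a b z * g i j z.

Lemma dv_kronecker c k a b i j z : A z ->
  vthird C e L c k a i b j z = hi a b z * dv c k (g i j) z.
Proof.
move=> Az; rewrite /vthird -[LHS]diffZ//; last by do 2 apply: smooth_diff.
rewrite (diff_eq _ (fun w Aw => kronecker a b i j Aw))// diffM//.
by rewrite dv_hi mul0r add0r.
Qed.

(* Contracting the totally symmetric third derivatives of L with h gives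
   p dg_ij/dv^k_c = dg_kj/dv^i_c, hence p^2 dg = dg. *)
Lemma dv_metric c k i j z : A z -> dv c k (g i j) z = 0.
Proof.
move=> Az.
have E k' i' : p%:R * dv c k' (g i' j) z = dv c i' (g k' j) z.
  have T a b : hi a b z * dv c k' (g i' j) z = hi c b z * dv a i' (g k' j) z.
    rewrite -!dv_kronecker// /vthird; congr (_ * _).
    by rewrite diff_comm//; apply: smooth_diff.
  transitivity (\sum_a \sum_b (hi a b z * dv c k' (g i' j) z) * h b a z).
    transitivity (\sum_(a < p) dv c k' (g i' j) z).
      by rewrite sumr_const card_ord mulr_natl.
    apply: eq_bigr => a _; rewrite -[LHS]mul1r -(_ : (a == a)%:R = 1)//; last by rewrite eqxx.
    by rewrite -(hi_h a a Az) mulr_suml; apply: eq_bigr => b _; ring.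
  transitivity (\sum_a (c == a)%:R * dv a i' (g k' j) z).
    apply: eq_bigr => a _; rewrite -(hi_h c a Az) mulr_suml.
    by apply: eq_bigr => b _; rewrite T; ring.
  rewrite (bigD1 c)//= eqxx mul1r big1 ?addr0// => a ac.
  by rewrite eq_sym (negPf ac) mul0r.
have := E k i; rewrite -(E i k) => /eqP.
rewrite mulrA -subr_eq0 -[X in _ - X]mul1r -mulrBl mulf_eq0.
move=> /orP[|/eqP->]; last by rewrite mulr0.
rewrite subr_eq0 -natrM -[1]/(1%:R) eqr_nat => /eqP pp.
by have := leq_mul p_gt1 p_gt1; rewrite pp.
Qed.

Lemma vthird0 c k a i b j z : A z -> vthird C e L c k a i b j z = 0.
Proof. by move=> Az; rewrite dv_kronecker// dv_metric// mulr0. Qed.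

Lemma dv_vlow_multi c k a i z : A z ->
  dv c k (vlow C e y L a i) z = hi c a z * g k i z.
Proof.
move=> Az; rewrite dv_vlow// /vhess kronecker//.
rewrite big1 ?addr0// => d _; rewrite big1// => l _.
by rewrite vthird0// mul0r.
Qed.

Lemma dv_vlow_sym_multi c a i k z : A z ->
  dv c k (vlow C e y L a i) z = dv c i (vlow C e y L a k) z.
Proof. by move=> Az; rewrite !dv_vlow_multi// g_sym. Qed.

(** Differentiate g g^-1 = 1, where g is constant along the fibres, and multiply by g^-1 on the
    left. *)
Lemma dv_ginv c k i j z : A z -> dv c k (gi i j) z = 0.
Proof.
move=> Az.
have E l : \sum_m g l m z * dv c k (gi m j) z = 0.
  transitivity (dv c k (fun w => \sum_m g l m w * gi m j w) z).
    rewrite diff_sum//; last by move=> m; apply: smoothM.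
    by apply: eq_bigr => m _; rewrite diffM// dv_metric// mul0r add0r.
  by rewrite (diff_eq _ (fun w Aw => g_gi l j Aw))// diff_cst.
transitivity (\sum_l gi i l z * \sum_m g l m z * dv c k (gi m j) z); last first.
  by rewrite big1// => l _; rewrite E mulr0.
under eq_bigr do rewrite mulr_sumr.
rewrite exchange_big/=.
transitivity (\sum_m (i == m)%:R * dv c k (gi m j) z).
  rewrite (bigD1 i)//= eqxx mul1r big1 ?addr0// => m mi.
  by rewrite eq_sym (negPf mi) mul0r.
apply: eq_bigr => m _; rewrite -(gi_g i m Az) mulr_suml.
by apply: eq_bigr => l _; ring.
Qed.

(** What remains of dL/dv after removing the derivative of the quadratic part h^ab g_ij x^i_a x^j_b.
    Being constant along the fibres, it equals its value at zero velocity, that is [Ucoef]; this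
    recovers the affine form of dL/dv, which appears below as the hypothesis [dv_L]. *)
Definition affine_part a i z :=
  dv a i L z - 2 * \sum_b \sum_q hi a b z * g i q z * y b q z.

Lemma smooth_quadratic a i :
  smooth (fun z => \sum_b \sum_q hi a b z * g i q z * y b q z).
Proof.
apply: smooth_sum => b; apply: smooth_sum => q.
by apply: smoothM => //; apply: smoothM.
Qed.

Lemma smooth_affine_part a i : smooth (affine_part a i).
Proof.
apply: smoothB; first exact: smooth_diff.
by apply: smoothM; [exact: smooth_cst|exact: smooth_quadratic].
Qed.

Lemma dv_affine_part c k a i z : A z -> dv c k (affine_part a i) z = 0.
Proof.
move=> Az; have sq := smooth_quadratic a i.
have sbq b q : smooth (fun z => hi a b z * g i q z * y b q z).
  by apply: smoothM => //; apply: smoothM.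
have sb b : smooth (fun z => \sum_q hi a b z * g i q z * y b q z).
  exact: smooth_sum.
rewrite (diffB _ Az (smooth_diff _ smooth_L) (smoothM (smooth_cst C 2) sq)).
rewrite (diffZ _ Az _ sq).
have -> : dv c k (fun z => \sum_b \sum_q hi a b z * g i q z * y b q z) z =
    hi a c z * g i k z.
  rewrite (diff_sum _ Az _ _ sb).
  transitivity (\sum_b \sum_q hi a b z * g i q z * ((c == b) && (k == q))%:R).
    apply: eq_bigr => b _; rewrite (diff_sum _ Az _ _ (sbq b)); apply: eq_bigr => q _.
    rewrite (diffM _ (smoothM (smooth_hi a b) (smooth_g i q)) (smooth_y b q) Az).
    rewrite (diffM _ (smooth_hi a b) (smooth_g i q) Az) dv_hi dv_metric// dv_y.
    by ring.
  rewrite (bigD1 c)//= (bigD1 k)//= !eqxx mulr1 !big1 ?addr0// => [b bc|q qk].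
    by rewrite big1// => q _; rewrite (eq_sym c) (negPf bc) mulr0.
  by rewrite (eq_sym k) (negPf qk) andbF mulr0.
by rewrite (g_sym i k Az) (hi_sym a c Az) -kronecker// mulVKf ?subrr// pnatr_eq0.
Qed.

Hypothesis dv_U : forall c k a i z, dv c k (U a i) z = 0.
Hypothesis dv_L : forall a i z, A z ->
  dv a i L z = U a i z + 2 * \sum_b \sum_q hi a b z * g i q z * y b q z.

(** The Christoffel symbols of g in the x variables, as in [christoffel_g]. *)
Definition spray_gamma i j k z :=
  \sum_m gi i m z / 2 * (dx k (g m j) z + dx j (g m k) z - dx m (g j k) z).
Definition multi_rest a i j z :=
  (\sum_k gi i k z / 2 * dt a (g j k) z)
  + \sum_k \sum_b gi i k z / 4 * h a b z * (dx j (U b k) z - dx k (U b j) z).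
(** Associated as in [Nconn_multi], to be convertible to it; [multi_connE] regroups it into a part
    linear in the velocities and the velocity-independent [multi_rest]. *)
Definition multi_conn a i j z :=
  (\sum_k spray_gamma i j k z * y a k z)
  + (\sum_k gi i k z / 2 * dt a (g j k) z)
  + \sum_k \sum_b gi i k z / 4 * h a b z * (dx j (U b k) z - dx k (U b j) z).

Lemma multi_connE a i j z :
  multi_conn a i j z = (\sum_k spray_gamma i j k z * y a k z) + multi_rest a i j z.
Proof. by rewrite /multi_conn /multi_rest addrA. Qed.

Lemma smooth_divr f : smooth f -> forall r : R, smooth (fun z => f z / r).
Proof. by move=> sf r; apply: smoothM => //; apply: smooth_cst. Qed.

Lemma smooth_spray_gamma i j k : smooth (spray_gamma i j k).
Proof.
apply: smooth_sum => m; apply: smoothM; first exact: smooth_divr.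
by apply: smoothB; [apply: smoothD|]; apply: smooth_diff.
Qed.

Lemma smooth_multi_rest a i j : smooth (multi_rest a i j).
Proof.
apply: smoothD; apply: smooth_sum => k.
  by apply: smoothM; [exact: smooth_divr|exact: smooth_diff].
apply: smooth_sum => b; apply: smoothM.
  by apply: smoothM => //; exact: smooth_divr.
by apply: smoothB; apply: smooth_diff.
Qed.

Lemma smooth_multi_conn a i j : smooth (multi_conn a i j).
Proof.
apply: (smooth_eq (fun z _ => esym (multi_connE a i j z))).
apply: smoothD; last exact: smooth_multi_rest.
by apply: smooth_sum => k; apply: smoothM => //; apply: smooth_spray_gamma.
Qed.

Lemma dv_diff_metric c k u i j z : A z -> dv c k (diff C u (g i j)) z = 0.
Proof.
move=> Az; rewrite diff_comm// (diff_eq _ (fun w Aw => dv_metric c k i j Aw))//.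
exact: diff_cst.
Qed.

Lemma dv_spray_gamma c l i j k z : A z -> dv c l (spray_gamma i j k) z = 0.
Proof.
move=> Az.
have sd u i' j' : smooth (diff C u (g i' j')) by apply: smooth_diff.
have sT m := smoothB (smoothD (sd (ux k) m j) (sd (ux j) m k)) (sd (ux m) j k).
have sgi m : smooth (fun z => gi i m z / 2) by apply: smooth_divr.
rewrite diff_sum//; last by move=> m; apply: smoothM.
apply: big1 => m _; rewrite (diffM _ (sgi m) (sT m) Az).
rewrite (diffB _ Az (smoothD (sd (ux k) m j) (sd (ux j) m k)) (sd (ux m) j k)).
rewrite (diffD _ (sd (ux k) m j) (sd (ux j) m k) Az) !dv_diff_metric//.
rewrite (diffM _ (smooth_gi i m) (smooth_cst C _) Az) dv_ginv// diff_cst.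
by rewrite !(mul0r, mulr0, addr0, subr0).
Qed.

Lemma dv_multi_rest c l a i j z : A z -> dv c l (multi_rest a i j) z = 0.
Proof.
move=> Az.
have sgi r m : smooth (fun z => gi i m z / r) by apply: smooth_divr.
have dgi r m : dv c l (fun z => gi i m z / r) z = 0.
  rewrite (diffM _ (smooth_gi i m) (smooth_cst C _) Az) dv_ginv// diff_cst.
  by rewrite mul0r mulr0 addr0.
have sU u b k : smooth (diff C u (U b k)) by apply: smooth_diff.
have dU u b k : dv c l (diff C u (U b k)) z = 0.
  by rewrite diff_comm// (diff_eq _ (fun w _ => dv_U c l b k w))// diff_cst.
have sd u i' j' : smooth (diff C u (g i' j')) by apply: smooth_diff.
have sk k : smooth (fun z => gi i k z / 2 * dt a (g j k) z) by apply: smoothM.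
have skb k b : smooth (fun z => gi i k z / 4 * h a b z * (dx j (U b k) z - dx k (U b j) z)).
  by apply: smoothM; [apply: smoothM|apply: smoothB].
have sks k : smooth (fun z => \sum_b gi i k z / 4 * h a b z * (dx j (U b k) z - dx k (U b j) z)).
  exact: smooth_sum.
rewrite (diffD _ (smooth_sum _ _ sk) (smooth_sum _ _ sks) Az).
rewrite (diff_sum _ Az _ _ sk) (diff_sum _ Az _ _ sks) !big1 ?addr0// => k _.
  rewrite (diff_sum _ Az _ _ (skb k)) big1// => b _.
  rewrite (diffM _ (smoothM (sgi 4 k) (smooth_h a b))
    (smoothB (sU (ux j) b k) (sU (ux k) b j)) Az).
  rewrite (diffM _ (sgi 4 k) (smooth_h a b) Az) (diffB _ Az (sU (ux j) b k) (sU (ux k) b j)).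
  by rewrite dgi dv_h !dU !(mul0r, mulr0, addr0, subr0).
by rewrite (diffM _ (sgi 2 k) (sd (ut a) j k) Az) dgi dv_diff_metric// mul0r mulr0 addr0.
Qed.

Lemma dv_multi_conn c k b m j z : A z ->
  dv c k (multi_conn b m j) z = (c == b)%:R * spray_gamma m j k z.
Proof.
move=> Az.
rewrite (diff_eq _ (fun w _ => multi_connE b m j w))//.
have sy l : smooth (fun z => spray_gamma m j l z * y b l z).
  by apply: smoothM => //; apply: smooth_spray_gamma.
rewrite (diffD _ (smooth_sum _ _ sy) (smooth_multi_rest b m j) Az) dv_multi_rest// addr0.
rewrite (diff_sum _ Az _ _ sy) (bigD1 k)//= big1 => [|l lk];
  rewrite (diffM _ (smooth_spray_gamma m j _) (smooth_y b _) Az) dv_spray_gamma// dv_y.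
  by rewrite eqxx andbT mul0r add0r addr0 mulrC.
by rewrite (eq_sym k) (negPf lk) andbF mul0r mulr0 addr0.
Qed.

Lemma spray_gamma_sym i j k z : A z -> spray_gamma i j k z = spray_gamma i k j z.
Proof.
move=> Az; apply: eq_bigr => m _; congr (_ * _).
by rewrite (diff_eq _ (fun w Aw => g_sym j k Aw))//; ring.
Qed.

Lemma multi_conn_sym c b m j k z : A z ->
  dv c k (multi_conn b m j) z = dv c j (multi_conn b m k) z.
Proof. by move=> Az; rewrite !dv_multi_conn// spray_gamma_sym. Qed.

Lemma lower_raise i z (T : 'I_n -> R) : A z ->
  \sum_m g i m z * (\sum_k gi m k z * T k) = T i.
Proof.
move=> Az; under eq_bigr do rewrite mulr_sumr.
rewrite exchange_big/=.
transitivity (\sum_k (i == k)%:R * T k).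
  by apply: eq_bigr => k _; rewrite -(g_gi _ _ Az) mulr_suml; apply: eq_bigr => m _; ring.
rewrite (bigD1 i)//= eqxx mul1r big1 ?addr0// => k ki.
by rewrite eq_sym (negPf ki) mul0r.
Qed.

Lemma multi_conn_low a i j z : A z ->
  \sum_m g i m z * multi_conn a m j z =
  2^-1 * (\sum_k (dx k (g i j) z + dx j (g i k) z - dx i (g j k) z) * y a k z)
  + 2^-1 * dt a (g j i) z
  + 4^-1 * \sum_b h a b z * (dx j (U b i) z - dx i (U b j) z).
Proof.
move=> Az; rewrite -(lower_raise i (fun i =>
  2^-1 * (\sum_k (dx k (g i j) z + dx j (g i k) z - dx i (g j k) z) * y a k z)
  + 2^-1 * dt a (g j i) z
  + 4^-1 * \sum_b h a b z * (dx j (U b i) z - dx i (U b j) z)) Az).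
apply: eq_bigr => m _; congr (_ * _).
rewrite /multi_conn.
have -> : \sum_k spray_gamma m j k z * y a k z = \sum_l gi m l z *
    (2^-1 * \sum_k (dx k (g l j) z + dx j (g l k) z - dx l (g j k) z) * y a k z).
  under eq_bigr do rewrite mulr_suml.
  rewrite exchange_big; apply: eq_bigr => l _ /=.
  by rewrite mulrA mulr_sumr; apply: eq_bigr => k _; ring.
have -> : \sum_k \sum_b gi m k z / 4 * h a b z * (dx j (U b k) z - dx k (U b j) z) =
    \sum_k gi m k z * (4^-1 * \sum_b h a b z * (dx j (U b k) z - dx k (U b j) z)).
  apply: eq_bigr => k _; rewrite !mulr_sumr; apply: eq_bigr => b _; ring.
rewrite -!big_split; apply: eq_bigr => k _ /=; ring.
Qed.

(** Contraction with the Hessian 2 h^ab g_im turns the U part of N, with its factor 1/4, into half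
    of dU_i/dx^j - dU_j/dx^i. Subtracted from dU_i/dx^j it leaves half the symmetric sum. Likewise
    the Christoffel part turns 2 S_ij into S_ij + S_ji, and [X] and [T] are symmetric because g
    is. *)
Lemma multi_lagrangian a i j z : A z ->
  xfield C ux e multi_conn j (dv a i L) z = xfield C ux e multi_conn i (dv a j L) z.
Proof.
move=> Az.
pose S i j := \sum_b hi a b z * \sum_k dx j (g i k) z * y b k z.
pose X i j := \sum_b hi a b z * \sum_k dx k (g i j) z * y b k z.
pose T i j := \sum_b hi a b z * dt b (g j i) z.
have Xsym : X j i = X i j.
  apply: eq_bigr => b _; congr (_ * _); apply: eq_bigr => k _.
  by rewrite (diff_eq _ (fun w Aw => g_sym j i Aw)).
have Tsym : T j i = T i j.
  by apply: eq_bigr => b _; rewrite (diff_eq _ (fun w Aw => g_sym j i Aw)).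
have E i' j' : xfield C ux e multi_conn j' (dv a i' L) z =
    2^-1 * (dx j' (U a i') z + dx i' (U a j') z) + S i' j' + S j' i' - X i' j' - T i' j'.
  rewrite /xfield /field.
  have -> : dx j' (dv a i' L) z = dx j' (U a i') z + 2 * S i' j'.
    have sbq b q : smooth (fun z => hi a b z * g i' q z * y b q z).
      by apply: smoothM => //; apply: smoothM.
    have sb b : smooth (fun z => \sum_q hi a b z * g i' q z * y b q z).
      exact: smooth_sum.
    have ss : smooth (fun z => \sum_b \sum_q hi a b z * g i' q z * y b q z).
      exact: smooth_sum.
    rewrite (diff_eq _ (fun w Aw => dv_L a i' Aw))//.
    rewrite (diffD _ (smooth_U a i') (smoothM (smooth_cst C 2) ss) Az) (diffZ _ Az _ ss).
    congr (_ + _ * _); rewrite (diff_sum _ Az _ _ sb); apply: eq_bigr => b _.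
    rewrite (diff_sum _ Az _ _ (sbq b)) mulr_sumr; apply: eq_bigr => q _.
    rewrite (diffM _ (smoothM (smooth_hi a b) (smooth_g i' q)) (smooth_y b q) Az).
    rewrite (diffM _ (smooth_hi a b) (smooth_g i' q) Az) dx_hi dx_y.
    by ring.
  have -> : \sum_b \sum_m multi_conn b m j' z * dv b m (dv a i' L) z =
      2 * \sum_b hi a b z * \sum_m g i' m z * multi_conn b m j' z.
    rewrite mulr_sumr; apply: eq_bigr => b _; rewrite !mulr_sumr; apply: eq_bigr => m _.
    have -> : dv b m (dv a i' L) z = 2 * (hi a b z * g i' m z).
      by rewrite (g_sym i' m Az) (hi_sym a b Az) -kronecker// mulVKf// pnatr_eq0.
    by ring.
  have -> : \sum_b hi a b z * \sum_m g i' m z * multi_conn b m j' z =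
     2^-1 * (X i' j' + S i' j' - S j' i') + 2^-1 * T i' j'
     + 4^-1 * (dx j' (U a i') z - dx i' (U a j') z).
    under eq_bigr do rewrite multi_conn_low//.
    have -> : dx j' (U a i') z - dx i' (U a j') z =
       \sum_b hi a b z * \sum_b0 h b b0 z * (dx j' (U b0 i') z - dx i' (U b0 j') z).
      under eq_bigr do rewrite mulr_sumr.
      rewrite exchange_big/=.
      transitivity (\sum_b (a == b)%:R * (dx j' (U b i') z - dx i' (U b j') z)).
        rewrite (bigD1 a)//= eqxx mul1r big1 ?addr0// => b ba.
        by rewrite eq_sym (negPf ba) mul0r.
      apply: eq_bigr => b _; rewrite -(hi_h a b Az) mulr_suml.
      by apply: eq_bigr => b0 _; ring.
    rewrite /X /S /T -big_split -sumrB !mulr_sumr -!big_split; apply: eq_bigr => b _ /=.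
    have -> : \sum_k (dx k (g i' j') z + dx j' (g i' k) z - dx i' (g j' k) z) * y b k z =
        \sum_k dx k (g i' j') z * y b k z + \sum_k dx j' (g i' k) z * y b k z
        - \sum_k dx i' (g j' k) z * y b k z.
      by rewrite -big_split -sumrB; apply: eq_bigr => k _ /=; ring.
    by ring.
  by field.
rewrite !E Xsym Tsym; ring.
Qed.

Section Torsion.
Variable H : 'I_p -> 'I_p -> 'I_p -> Z -> R.

(** The vertical derivative of N is a Christoffel symbol of g, so the last sum cancels the part of H
    N that is linear in the velocities. Only H contracted with [multi_rest] remains, the factor 1/4
    there being the product of the two factors 1/2 on the left. *)
Lemma torsion_multi m mu a j z : A z ->
  - dt a (multi_conn mu m j) z
  + \sum_k \sum_b gi m k z / 2 * H b mu a z
    * (dt b (g j k) z + \sum_c h b c z / 2 * (dx j (U c k) z - dx k (U c j) z)) =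
  - dt a (multi_conn mu m j) z + \sum_c H c mu a z * multi_conn c m j z
  - \sum_nu \sum_k (\sum_c H c nu a z * y c k z) * dv nu k (multi_conn mu m j) z.
Proof.
move=> Az; rewrite -addrA; congr (_ + _).
have -> : \sum_nu \sum_k (\sum_c H c nu a z * y c k z) * dv nu k (multi_conn mu m j) z =
    \sum_c H c mu a z * \sum_k spray_gamma m j k z * y c k z.
  rewrite (bigD1 mu)//= [X in _ + X]big1 ?addr0 => [|nu numu]; last first.
    by rewrite big1// => k _; rewrite dv_multi_conn// (negPf numu) mul0r mulr0.
  under [RHS]eq_bigr do rewrite mulr_sumr.
  rewrite exchange_big; apply: eq_bigr => k _.
  rewrite dv_multi_conn// eqxx mul1r mulr_suml; apply: eq_bigr => c _; ring.
rewrite -sumrB exchange_big; apply: eq_bigr => b _ /=.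
rewrite -mulrBr multi_connE addrAC subrr add0r /multi_rest mulrDr !mulr_sumr -big_split.
apply: eq_bigr => k _ /=; rewrite mulrDr; congr (_ + _); first by ring.
by rewrite !mulr_sumr; apply: eq_bigr => c _; field.
Qed.

End Torsion.

End MultiTime.

(** * Induced coordinates and coordinate expressions *)

Section Directions.
Context {R : realType} {p n : nat}.

Definition dir_t (c : 'I_p) : coords R p n := (delta_mx 0 c, 0, 0).
Definition dir_x (i : 'I_n) : coords R p n := (0, delta_mx 0 i, 0).
Definition dir_v (c : 'I_p) (i : 'I_n) : coords R p n := (0, 0, delta_mx c i).
Definition velocity (c : 'I_p) (i : 'I_n) (z : coords R p n) : R := z.2 c i.

End Directions.

Section CoordinateCalculus.
Context {R : realType} {p n : nat}.
Variables (A : set (coords R p n)).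
Hypothesis A_open : open A.

Definition coords_calculus : calculus R (coords R p n) (coords R p n).
Proof.
refine (@Calculus R (coords R p n) (coords R p n) A (fun f => smooth_on A f)
  (fun u f z => 'D_u f z) _ _ _ _ _ _ _ _ _ _).
- exact: smooth_on_cst.
- exact: smooth_onD.
- exact: smooth_onM.
- exact: smooth_on_eq.
- by move=> u f sf; apply: smooth_on_derive.
- by move=> u r z; apply: derive_cst.
- by move=> u f g z sf sg Az; apply: derive_onD sf sg.
- by move=> u f g z sf sg Az; apply: derive_onM sf sg.
- by move=> u f g z fg Az; apply: derive_eq_on fg Az.
- by move=> u w f z sf Az; apply: derive_comm sf Az.
(* Transparent, so that [smooth] and [diff] of this calculus unfold to [smooth_on] and directional
   derivatives in the conversions below. *)
Defined.

End CoordinateCalculus.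

Section LocalGeometry.
Context {R : realType} {p n : nat}.
Variables (A : set (coords R p n)) (A_open : open A) (K : local_geom R p n).
Let CA := coords_calculus A_open.
Local Notation ut := (@dir_t R p n).
Local Notation ux := (@dir_x R p n).
Local Notation e := (@dir_v R p n).
Local Notation y := (@velocity R p n).
Let H : 'I_p -> 'I_p -> 'I_p -> coords R p n -> R := christoffel_h (hl K).
Let M (b c : 'I_p) (j : 'I_n) : coords R p n -> R := Mconn (hl K) b c j.
Let N := nconn K.

Hypothesis smooth_H : forall a b c, smooth CA (H a b c).
Hypothesis smooth_N : forall b i j, smooth CA (N b i j).
Hypothesis smooth_g : forall i j, smooth CA (gdn (gl K) i j).
Hypothesis smooth_ginv : forall i j, smooth CA (ginv (gl K) i j).
Hypothesis smooth_L : smooth CA (Ll K).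
Hypothesis g_sym : forall i j z, A z -> gdn (gl K) i j z = gdn (gl K) j i z.

Lemma continuous_velocity (a : 'I_p) (i : 'I_n) : continuous (y a i).
Proof.
move=> z; apply: (@continuous_comp _ _ _ snd (fun v : 'M[R]_(p, n) => v a i)).
  exact: cvg_snd.
exact: coord_continuous.
Qed.

Lemma velocity_linear a i (r : R) z w : y a i (r *: z + w) = r * y a i z + y a i w.
Proof. by rewrite /velocity !mxE. Qed.

Lemma smooth_velocity a i : smooth CA (y a i).
Proof.
exact: (smooth_on_linear (@velocity_linear a i) (@continuous_velocity a i)).
Qed.

Lemma dv_velocity c k a i z : diff CA (e c k) (y a i) z = ((c == a) && (k == i))%:R.
Proof.
rewrite [LHS](derive_linear (@velocity_linear a i)) /velocity /dir_v mxE.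
by rewrite (eq_sym a) (eq_sym i).
Qed.

Lemma dx_velocity k a i z : diff CA (ux k) (y a i) z = 0.
Proof. by rewrite [LHS](derive_linear (@velocity_linear a i)) /velocity mxE. Qed.

Lemma smooth_Mconn b c j : smooth CA (M b c j).
Proof.
apply: (smoothN (C := CA)); apply: smooth_sum => a.
exact: smoothM (smooth_H _ _ _) (smooth_velocity _ _).
Qed.

Lemma smooth_adt c f : smooth CA f -> smooth CA (adt K c f).
Proof. exact: (smooth_tfield (C := CA) ut e smooth_Mconn). Qed.

Lemma smooth_Gcart k j c : smooth CA (Gcart K k j c).
Proof.
apply: smooth_sum => i.
exact: smoothM (smoothM (smooth_ginv _ _) (smooth_cst CA _)) (smooth_adt _ (smooth_g _ _)).
Qed.

Lemma smooth_xlow a i : smooth CA (xlow K a i).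
Proof. exact: (smooth_vlow e smooth_velocity smooth_L a i). Qed.

Lemma Lcart_sym i j k z : A z -> Lcart K i j k z = Lcart K i k j z.
Proof.
move=> Az; apply: eq_bigr => m _; congr (_ * _).
have -> : adx K m (gdn (gl K) j k) z = adx K m (gdn (gl K) k j) z.
  exact: (field_eq (C := CA) e (ux m) (fun b l => N b l m) Az (g_sym j k)).
by rewrite [X in X - _]addrC.
Qed.

Lemma Ccart_sym i c j k z : A z -> Ccart K i c j k z = Ccart K i c k j z.
Proof.
move=> Az; apply: eq_bigr => m _; congr (_ * _).
have -> : dv c m (gdn (gl K) j k) z = dv c m (gdn (gl K) k j) z.
  exact: (diff_eq (c := CA) (e c m) (g_sym j k) Az).
by rewrite [X in X - _]addrC.
Qed.

(** [Fem] and the covariant derivatives are convertible to their abstract counterparts; what has to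
    be supplied is the closed form of the torsion, whose definition depends on p. *)
Lemma local_maxwell_time Rt a b i k z : A z ->
  (forall a b c k z, diff CA (ux k) (H a b c) z = 0) ->
  (forall a b c d k z, diff CA (e d k) (H a b c) z = 0) ->
  (forall m mu b k, Rt m mu b k z = - dt b (N mu m k) z + \sum_c H c mu b z * N c m k z
    - \sum_nu \sum_j (\sum_c H c nu b z * z.2 c j) * dv nu j (N mu m k) z) ->
  covt_tU_xDD K (Fem K) a i k b z = maxwell_rhs K Rt a b z i k.
Proof.
move=> Az dx_H dv_H RtE.
have M_def a' b' i' z' : M a' b' i' z' = - \sum_c H c a' b' z' * y c i' z' by [].
have RtE' m mu b' k' : Rt m mu b' k' z =
    xfield CA ux e N k' (M mu b' m) z - tfield CA ut e M b' (N mu m k') z.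
  rewrite RtE; apply/esym.
  exact: (torsion_time ut smooth_velocity dv_velocity dx_velocity N smooth_H dx_H dv_H
    M_def m mu b' k' Az).
exact (@maxwell_time R (coords R p n) (coords R p n) CA p n ut ux e M N H (Gcart K)
  (Lcart K) (Ccart K) (xlow K) smooth_Mconn smooth_N smooth_H smooth_Gcart
  smooth_xlow Lcart_sym Rt z Az (fun a b c k => xfield_H N dx_H dv_H a b c k z) RtE' a b i k).
Qed.

Lemma local_maxwell_space a i j k z : A z ->
  (forall a i j z, A z ->
    adx K j (dv a i (Ll K)) z = adx K i (dv a j (Ll K)) z) ->
  cyclic (fun i j k => covx_tU_xDD K (Fem K) a i j k z) i j k =
  - 2^-1 * cyclic (fun i j k => \sum_m \sum_mu
     (adx K k (N mu m j) z - adx K j (N mu m k) z) *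
     \sum_c \sum_l vthird CA e (Ll K) mu m a i c l z * z.2 c l) i j k.
Proof.
move=> Az lagrangian.
have -> : cyclic (fun i j k => covx_tU_xDD K (Fem K) a i j k z) i j k = _ :=
  @maxwell_space R (coords R p n) (coords R p n) CA p n ux e N
  (Lcart K) (xlow K) smooth_N smooth_xlow Lcart_sym a i j k z Az.
congr (_ * _).
exact: (@cyclic_curvature_vlow R (coords R p n) (coords R p n) CA p n ux e y
  smooth_velocity dv_velocity (Ll K) smooth_L N smooth_N lagrangian a i j k z Az).
Qed.

Lemma local_maxwell_vertical a c i j k z : A z ->
  (forall i j z, A z -> diff CA (e c j) (xlow K a i) z = diff CA (e c i) (xlow K a j) z) ->
  (forall b m j k, dv c k (N b m j) z = dv c j (N b m k) z) ->
  cyclic (fun i j k => covv_tU_xDD K (Fem K) a i j c k z) i j k = 0.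
Proof.
move=> Az x_sym N_sym.
exact (@maxwell_vertical R (coords R p n) (coords R p n) CA p n ux e N
  (Lcart K) (Ccart K) (xlow K) smooth_N smooth_xlow Lcart_sym a c i j k z Az x_sym N_sym
  (fun m i k => Ccart_sym m c i k Az)).
Qed.

End LocalGeometry.

Section InducedCoordinates.
Context {R : realType} {p n : nat} {T : manifold R p} {M : manifold R n}.
Context {h : metric T} (S : ML_space M h).
Variables (c : chart R p T) (d : chart R n M).
Hypotheses (atlas_c : atlas c) (atlas_d : atlas d).

Let time (z : coords R p n) : 'rV[R]_p := z.1.1.
Let at_rest (z : coords R p n) : coords R p n := (z.1, 0).

Lemma continuous_time : continuous time.
Proof.
move=> z; apply: (@continuous_comp _ _ _ fst fst); exact: cvg_fst.
Qed.

Lemma time_linear (r : R) z w : time (r *: z + w) = r *: time z + time w.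
Proof. by []. Qed.

Lemma continuous_at_rest : continuous at_rest.
Proof.
move=> z; have cz : (fun w : coords R p n => w.1) @ z --> z.1 by exact: cvg_fst.
have c0 : (fun _ : coords R p n => 0 : 'M[R]_(p, n)) @ z --> (0 : 'M[R]_(p, n)).
  exact: cvg_cst.
exact: (cvg_pair cz c0).
Qed.

Lemma at_rest_linear (r : R) z w : at_rest (r *: z + w) = r *: at_rest z + at_rest w.
Proof.
have -> : r *: at_rest z + at_rest w = ((r *: z + w).1, r *: 0 + 0) by [].
by rewrite scaler0 addr0.
Qed.

Lemma open_jet_dom : open (jet_dom c d).
Proof.
have -> : jet_dom c d = (fun z : coords R p n => z.1.1) @^-1` img c `&`
    (fun z : coords R p n => z.1.2) @^-1` img d by [].
apply: openI; (apply: open_comp; last exact: img_open) => z _.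
  exact: continuous_time.
by apply: (@continuous_comp _ _ _ fst snd); [exact: cvg_fst|exact: cvg_snd].
Qed.

Let CA := coords_calculus open_jet_dom.
Local Notation ux := (@dir_x R p n).
Local Notation e := (@dir_v R p n).

Lemma smooth_time (f : 'rV[R]_p -> R) : smooth_on (img c) f ->
  smooth CA (fun z => f z.1.1).
Proof.
by apply: (smooth_on_pullback time_linear continuous_time) => z [].
Qed.

Lemma dv_time (f : 'rV[R]_p -> R) a i z : diff CA (e a i) (fun z => f z.1.1) z = 0.
Proof. by rewrite [LHS](derive_pullback time_linear) derive0. Qed.

Lemma dx_time (f : 'rV[R]_p -> R) i z : diff CA (ux i) (fun z => f z.1.1) z = 0.
Proof. by rewrite [LHS](derive_pullback time_linear) derive0. Qed.

Lemma dom_param s : img c s -> dom c (param c s).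
Proof. by case=> t ct <-; rewrite coordK. Qed.

Lemma h_unit s : img c s -> h_loc (h := h) c s \in unitmx.
Proof. by move=> /dom_param; apply: metric_nondeg. Qed.

Lemma smooth_h_entry a b : smooth_on (img c) (fun s => h_loc (h := h) c s a b).
Proof. exact: Defs.metric_smooth. Qed.

Lemma smooth_hinv_entry a b :
  smooth_on (img c) (fun s => invmx (h_loc (h := h) c s) a b).
Proof. exact (@smooth_on_invmx _ _ _ (@img_open _ _ _ c) _ _ smooth_h_entry h_unit a b). Qed.

(** [christoffel_h] as a function of t alone, so that its smoothness and the vanishing of its x and
    v derivatives follow by pullback along the projection to t. *)
Definition christoffel_entry (a b b' : 'I_p) (s : 'rV[R]_p) : R :=
  \sum_e invmx (h_loc (h := h) c s) a e / 2 *
   ('D_(delta_mx 0 b') (fun s => h_loc (h := h) c s e b) s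
    + 'D_(delta_mx 0 b) (fun s => h_loc (h := h) c s e b') s
    - 'D_(delta_mx 0 e) (fun s => h_loc (h := h) c s b b') s).

Lemma christoffelE a b b' :
  christoffel_h (h_loc (h := h) c) a b b' =
  (fun z : coords R p n => christoffel_entry a b b' z.1.1).
Proof. by []. Qed.

Lemma smooth_christoffel a b b' : smooth CA (christoffel_h (h_loc (h := h) c) a b b').
Proof.
rewrite christoffelE; apply: smooth_time.
have oc : open (img c) by exact: img_open.
apply: (smooth_on_sum oc) => l.
have sd k i j : smooth_on (img c) (fun s => 'D_(delta_mx 0 k)
    (fun s => h_loc (h := h) c s i j) s).
  exact: smooth_on_derive _ (smooth_h_entry i j).
apply: (smooth_onM oc).
  exact: (smooth_onM oc (smooth_hinv_entry _ _) (smooth_on_cst oc _)).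
exact: (smooth_onB oc (smooth_onD oc (sd _ _ _) (sd _ _ _)) (sd _ _ _)).
Qed.

Lemma smooth_g_entry i j : smooth CA (gdn (g_loc S c d) i j).
Proof. exact: fundamental_smooth. Qed.

Lemma g_unit z : jet_dom c d z -> g_loc S c d z \in unitmx.
Proof.
move=> Az; rewrite -row_free_unit /row_free /g_loc.
by rewrite (fundamental_rank S atlas_c atlas_d Az).
Qed.

Lemma smooth_ginv_entry i j : smooth CA (ginv (g_loc S c d) i j).
Proof. exact (@smooth_on_invmx _ _ _ open_jet_dom _ _ smooth_g_entry g_unit i j). Qed.

Lemma g_loc_sym i j z : jet_dom c d z -> gdn (g_loc S c d) i j z = gdn (g_loc S c d) j i z.
Proof.
move=> Az; rewrite /gdn /g_loc -[in LHS](fundamental_sym S atlas_c atlas_d Az).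
by rewrite mxE.
Qed.

Lemma g_ginv i k z : jet_dom c d z ->
  \sum_m gdn (g_loc S c d) i m z * ginv (g_loc S c d) m k z = (i == k)%:R.
Proof.
move=> /g_unit/mulmxV/matrixP/(_ i k); rewrite !mxE => <-.
by apply: eq_bigr.
Qed.

Lemma ginv_g i k z : jet_dom c d z ->
  \sum_m ginv (g_loc S c d) i m z * gdn (g_loc S c d) m k z = (i == k)%:R.
Proof.
move=> /g_unit/mulVmx/matrixP/(_ i k); rewrite !mxE => <-.
by apply: eq_bigr.
Qed.

Lemma hinv_h a b z : jet_dom c d z ->
  \sum_k hinv (n := n) (h_loc (h := h) c) a k z * h_loc (h := h) c z.1.1 k b = (a == b)%:R.
Proof.
move=> [/h_unit/mulVmx/matrixP/(_ a b)]; rewrite !mxE => E _; rewrite -E.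
by apply: eq_bigr.
Qed.

Lemma hinv_sym a b z : jet_dom c d z ->
  hinv (n := n) (h_loc (h := h) c) a b z = hinv (h_loc (h := h) c) b a z.
Proof.
move=> [cz _]; rewrite /hinv; set B := h_loc c z.1.1.
have -> : invmx B a b = (invmx B)^T b a by rewrite mxE.
by rewrite trmx_inv /B /h_loc (Defs.metric_sym h atlas_c (dom_param cz)).
Qed.

Lemma smooth_L_loc : smooth CA (L_loc S c d).
Proof. exact: lagrangian_smooth. Qed.

Lemma kronecker_loc a b i j z : jet_dom c d z ->
  2^-1 * diff CA (e a i) (diff CA (e b j) (L_loc S c d)) z =
  hinv (h_loc (h := h) c) a b z * gdn (g_loc S c d) i j z.
Proof. move=> Az; exact (kronecker_regular S atlas_c atlas_d Az a b i j). Qed.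

(** [jet_dom] restricts only t and x, so each fibre is a full matrix space. The velocity is reached
    from zero by adding one multiple of a matrix unit at a time, and f is constant along each such
    line. *)
Lemma vertical_constant f z : smooth CA f ->
  (forall a i w, jet_dom c d w -> diff CA (e a i) f w = 0) ->
  jet_dom c d z -> f z = f (at_rest z).
Proof.
move=> sf df0 Az.
have H (r : seq ('I_p * 'I_n)) :
    f (z.1, \sum_(s <- r) z.2 s.1 s.2 *: delta_mx s.1 s.2) = f (at_rest z).
  elim: r => [|s r IH]; first by rewrite big_nil.
  rewrite big_cons -{}IH.
  pose w : coords R p n := (z.1, \sum_(s <- r) z.2 s.1 s.2 *: delta_mx s.1 s.2).
  have line (t : R) : (z.1, t *: delta_mx s.1 s.2 + w.2) = t *: e s.1 s.2 + w.
    have -> : t *: e s.1 s.2 + w =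
      (t *: 0 + z.1.1, t *: 0 + z.1.2, t *: delta_mx s.1 s.2 + w.2) by [].
    by rewrite !scaler0 !add0r -surjective_pairing.
  rewrite (line (z.2 s.1 s.2)).
  apply: (derive0_line (A := jet_dom c d) _ sf) => [t|v Av].
    by rewrite -line.
  exact: df0.
rewrite -(H (index_enum _)) [in LHS](surjective_pairing z); congr (f (_, _)).
rewrite [LHS]matrix_sum_delta pair_bigA/=; apply: eq_bigr => s _.
by [].
Qed.

End InducedCoordinates.

Lemma cyclic0 (R : realType) (n : nat) (E : 'I_n -> 'I_n -> 'I_n -> R) i j k :
  (forall i j k, E i j k = 0) -> cyclic E i j k = 0.
Proof. by move=> E0; rewrite /cyclic !E0 !addr0. Qed.

Lemma eq_cyclic (R : realType) (n : nat) (E F : 'I_n -> 'I_n -> 'I_n -> R) i j k :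
  (forall i j k, E i j k = F i j k) -> cyclic E i j k = cyclic F i j k.
Proof. by move=> EF; rewrite /cyclic !EF. Qed.

(** * Maxwell equations for p >= 2 *)

Section MultiTimeMaxwell.
Context {R : realType} {p n : nat} {T : manifold R p} {M : manifold R n}.
Context {h : metric T} (S : ML_space M h).
Variables (c : chart R p T) (d : chart R n M).
Hypotheses (p_gt1 : (1 < p)%N) (atlas_c : atlas c) (atlas_d : atlas d).
Let CA := coords_calculus (@open_jet_dom R p n T M c d).
Local Notation ut := (@dir_t R p n).
Local Notation ux := (@dir_x R p n).
Local Notation e := (@dir_v R p n).
Local Notation y := (@velocity R p n).
Let hl := h_loc (h := h) c.
Let L := L_loc S c d.
Let g := gdn (g_loc S c d).
Let gi := ginv (g_loc S c d).
Let hi : 'I_p -> 'I_p -> coords R p n -> R := hinv hl.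
Let ht (a b : 'I_p) (z : coords R p n) : R := hl z.1.1 a b.
Let U := Ucoef L.

Let s_y a i : smooth CA (y a i) := smooth_velocity _ a i.
Let s_h a b : smooth CA (ht a b) := smooth_time (smooth_h_entry atlas_c a b).
Let s_hi a b : smooth CA (hi a b) := smooth_time (smooth_hinv_entry atlas_c a b).
Let s_g i j : smooth CA (g i j) := smooth_g_entry S atlas_c atlas_d i j.
Let s_gi i j : smooth CA (gi i j) := smooth_ginv_entry S atlas_c atlas_d i j.
Let s_L : smooth CA L := smooth_L_loc S atlas_c atlas_d.
Let s_H a b b' : smooth CA (christoffel_h hl a b b') := smooth_christoffel atlas_c a b b'.
Let d_y a i b j z : diff CA (e a i) (y b j) z = ((a == b) && (i == j))%:R :=
  dv_velocity _ a i b j z.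
Let dx_y i b j z : diff CA (ux i) (y b j) z = 0 := dx_velocity _ i b j z.
Let dv_hi a i b b' z : diff CA (e a i) (hi b b') z = 0.
Proof. exact (dv_time c d (fun s => invmx (hl s) b b') a i z). Qed.
Let dv_h a i b b' z : diff CA (e a i) (ht b b') z = 0.
Proof. exact (dv_time c d (fun s => hl s b b') a i z). Qed.
Let dx_hi i b b' z : diff CA (ux i) (hi b b') z = 0.
Proof. exact (dx_time c d (fun s => invmx (hl s) b b') i z). Qed.
Let hi_s a b z : jet_dom c d z -> hi a b z = hi b a z.
Proof. exact: hinv_sym. Qed.
Let hi_h a b z : jet_dom c d z -> \sum_k hi a k z * ht k b z = (a == b)%:R.
Proof. exact: hinv_h. Qed.
Let g_s i j z : jet_dom c d z -> g i j z = g j i z.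
Proof. exact: g_loc_sym. Qed.
Let g_gi i k z : jet_dom c d z -> \sum_m g i m z * gi m k z = (i == k)%:R.
Proof. exact: g_ginv. Qed.
Let gi_g i k z : jet_dom c d z -> \sum_m gi i m z * g m k z = (i == k)%:R.
Proof. exact: ginv_g. Qed.
Let kron a b i j z : jet_dom c d z ->
  2^-1 * diff CA (e a i) (diff CA (e b j) L) z = hi a b z * g i j z.
Proof. exact: kronecker_loc. Qed.

Let s_U a i : smooth CA (U a i).
Proof.
have rest z : jet_dom c d z -> jet_dom c d (z.1, 0) by [].
exact (smooth_on_pullback (@at_rest_linear R p n) (@continuous_at_rest R p n) rest
  (smooth_diff (c := CA) (e a i) s_L)).
Qed.

Let dv_U a i b j z : diff CA (e a i) (U b j) z = 0.
Proof.
(* [U] is a derivative of L composed with [at_rest], which sends every vertical direction to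
   zero. *)
have -> : diff CA (e a i) (U b j) z =
    'D_(0, 0, 0) (dv b j L) (z.1, 0 : 'M[R]_(p, n)).
  exact: (derive_pullback (@at_rest_linear R p n)).
exact: derive0.
Qed.

(** [affine_part] is constant along the fibres, and at zero velocity its sum over the velocities
    vanishes and leaves [U]. *)
Let dv_L a i z : jet_dom c d z -> diff CA (e a i) L z =
  U a i z + 2 * \sum_b \sum_q hi a b z * g i q z * y b q z.
Proof.
move=> Az.
have sW := smooth_affine_part e s_y s_hi s_g s_L a i.
have dW b j := dv_affine_part p_gt1 s_y s_hi s_g s_L d_y dv_hi hi_s hi_h g_s kron b j a i.
have := vertical_constant sW dW Az; rewrite {2}/affine_part.
rewrite [X in _ - 2 * X]big1 => [|b _]; last first.
  by rewrite big1// => q _; rewrite /velocity/= mxE mulr0.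
by rewrite mulr0 subr0 -[diff _ _ _ (_, _)]/(U a i z) => <-; rewrite subrK.
Qed.

Let K := canonical_multi S c d.

Let s_N b i j : smooth CA (nconn K b i j).
Proof. exact (smooth_multi_conn ut ux s_y s_h s_g s_gi s_U b i j). Qed.

Lemma maxwell_time_multi (a b : 'I_p) (i k : 'I_n) z : jet_dom c d z ->
  covt_tU_xDD K (Fem K) a i k b z = maxwell_rhs K (Rt_multi K) a b z i k.
Proof.
move=> Az; apply: (local_maxwell_time (K := K) s_H s_N s_g s_gi s_L g_s a b i k Az).
- by move=> a' b' b'' k' w; rewrite christoffelE; apply: dx_time.
- by move=> a' b' b'' k' a'' w; rewrite christoffelE; apply: dv_time.
- move=> m mu b' k'.
  exact (torsion_multi ut ux p_gt1 s_y s_h s_hi s_g s_gi s_L s_U d_y dv_h dv_hi hi_h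
    g_gi gi_g kron dv_U (christoffel_h hl) m mu b' k' Az).
Qed.

Lemma maxwell_space_multi (a : 'I_p) (i j k : 'I_n) z : jet_dom c d z ->
  cyclic (fun i j k => covx_tU_xDD K (Fem K) a i j k z) i j k = 0.
Proof.
move=> Az; rewrite (local_maxwell_space (K := K) s_N s_L g_s a i j k Az); last first.
  exact (multi_lagrangian ut s_y s_hi s_g s_U dx_y dx_hi hi_s hi_h g_s g_gi kron dv_L).
have V0 i' j' k' : \sum_m \sum_mu
     (adx K k' (nconn K mu m j') z - adx K j' (nconn K mu m k') z) *
     (\sum_c0 \sum_l vthird CA e L mu m a i' c0 l z * z.2 c0 l) = 0.
  rewrite big1// => m _; rewrite big1// => mu _.
  rewrite [X in _ * X]big1 ?mulr0// => b _; rewrite big1// => l _.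
  by rewrite (vthird0 p_gt1 s_hi s_g s_L dv_hi hi_h kron)// mul0r.
by rewrite (cyclic0 _ _ _ V0) mulr0.
Qed.

Lemma maxwell_vertical_multi (a c' : 'I_p) (i j k : 'I_n) z : jet_dom c d z ->
  cyclic (fun i j k => covv_tU_xDD K (Fem K) a i j c' k z) i j k = 0.
Proof.
move=> Az.
apply: (local_maxwell_vertical (K := K) s_N s_L g_s (a := a) (c := c') i j k Az).
  move=> i' j' w Aw.
  exact (dv_vlow_sym_multi p_gt1 s_y s_hi s_g s_L d_y dv_hi hi_h g_s kron c' a i' j' Aw).
move=> b m j' k'.
exact (multi_conn_sym ut ux p_gt1 s_y s_h s_hi s_g s_gi s_L s_U d_y dv_h dv_hi hi_h g_s
    g_gi gi_g kron dv_U c' b m j' k' Az).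
Qed.

End MultiTimeMaxwell.

(** * Maxwell equations for p = 1 *)

Section SingleTimeMaxwell.
Context {R : realType} {n : nat} {T : manifold R 1} {M : manifold R n}.
Context {h : metric T} (S : ML_space M h).
Variables (c : chart R 1 T) (d : chart R n M).
Hypotheses (atlas_c : atlas c) (atlas_d : atlas d).
Let CA := coords_calculus (@open_jet_dom R 1 n T M c d).
Local Notation ut := (@dir_t R 1 n).
Local Notation ux := (@dir_x R 1 n).
Local Notation e := (@dir_v R 1 n).
Local Notation y := (@velocity R 1 n).
Let hl := h_loc (h := h) c.
Let L := L_loc S c d.
Let g := gdn (g_loc S c d).
Let gi := ginv (g_loc S c d).
Let hi : coords R 1 n -> R := hinv hl ord0 ord0.
Let ht (z : coords R 1 n) : R := hl z.1.1 ord0 ord0.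
Let H : coords R 1 n -> R := christoffel_h hl ord0 ord0 ord0.

Let s_y a i : smooth CA (y a i) := smooth_velocity _ a i.
Let s_h : smooth CA ht := smooth_time (smooth_h_entry atlas_c ord0 ord0).
Let s_hi : smooth CA hi := smooth_time (smooth_hinv_entry atlas_c ord0 ord0).
Let s_g i j : smooth CA (g i j) := smooth_g_entry S atlas_c atlas_d i j.
Let s_gi i j : smooth CA (gi i j) := smooth_ginv_entry S atlas_c atlas_d i j.
Let s_L : smooth CA L := smooth_L_loc S atlas_c atlas_d.
Let s_H a b b' : smooth CA (christoffel_h hl a b b') := smooth_christoffel atlas_c a b b'.
Let d_y a i b j z : diff CA (e a i) (y b j) z = ((a == b) && (i == j))%:R :=
  dv_velocity _ a i b j z.
Let d_y0 i j z : diff CA (e ord0 i) (y ord0 j) z = (i == j)%:R :=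
  dv_velocity _ ord0 i ord0 j z.
Let dv_hi i z : diff CA (e ord0 i) hi z = 0.
Proof. exact (dv_time c d (fun s => invmx (hl s) ord0 ord0) ord0 i z). Qed.
Let dv_h i z : diff CA (e ord0 i) ht z = 0.
Proof. exact (dv_time c d (fun s => hl s ord0 ord0) ord0 i z). Qed.
Let dv_H i z : diff CA (e ord0 i) H z = 0.
Proof. exact (dv_time c d (christoffel_entry (h := h) c ord0 ord0 ord0) ord0 i z). Qed.
Let h_hi z : jet_dom c d z -> ht z * hi z = 1.
Proof.
by move=> /(hinv_h (h := h) atlas_c ord0 ord0); rewrite big_ord1 mulrC.
Qed.
Let g_s i j z : jet_dom c d z -> g i j z = g j i z.
Proof. exact: g_loc_sym. Qed.
Let g_gi i k z : jet_dom c d z -> \sum_m g i m z * gi m k z = (i == k)%:R.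
Proof. exact: g_ginv. Qed.
Let kron i j z : jet_dom c d z ->
  2^-1 * diff CA (e ord0 i) (diff CA (e ord0 j) L) z = hi z * g i j z.
Proof. exact: kronecker_loc. Qed.

Let K := canonical1 S c d.

Let s_N b i j : smooth CA (nconn K b i j).
Proof.
exact (smooth_spray_conn (ut ord0) ux e (s_y ord0) s_h s_hi (s_H _ _ _) s_L s_g s_gi b i j).
Qed.

Lemma maxwell_time_single i k z : jet_dom c d z ->
  covt_tU_xDD K (Fem K) ord0 i k ord0 z = maxwell_rhs K (Rt1 K) ord0 ord0 z i k.
Proof.
move=> Az; apply: (local_maxwell_time (K := K) s_H s_N s_g s_gi s_L g_s ord0 ord0 i k Az).
- by move=> a' b' b'' k' w; rewrite christoffelE; apply: dx_time.
- by move=> a' b' b'' k' a'' w; rewrite christoffelE; apply: dv_time.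
(* With a single temporal index the closed form of [torsion_time] becomes [Rt1] once the product
   with H is distributed. *)
- move=> m mu b' k'; rewrite (ord1 mu) (ord1 b') /Rt1 !big_ord1 -addrA; congr (_ + _).
  rewrite mulrBr mulr_sumr; congr (_ - _); apply: eq_bigr => l _.
  by rewrite big_ord1 mulrAC -mulrA.
Qed.

Lemma maxwell_space_single i j k z : jet_dom c d z ->
  cyclic (fun i j k => covx_tU_xDD K (Fem K) ord0 i j k z) i j k
  = - 2^-1 * cyclic (fun i j k =>
      \sum_l \sum_m Cvert K i l m z * Rx1 K m j k z * z.2 ord0 l) i j k.
Proof.
move=> Az; rewrite (local_maxwell_space (K := K) s_N s_L g_s ord0 i j k Az); last first.
  move=> a i' j' w Aw; rewrite (ord1 a).
  exact (spray_lagrangian (ut ord0) ux (s_y ord0) s_hi (s_H _ _ _) s_L s_g s_gi d_y0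
    dv_hi dv_H h_hi g_s g_gi kron i' j' Aw).
congr (_ * _).
have E i' j' k' : \sum_m \sum_mu
     (adx K k' (nconn K mu m j') z - adx K j' (nconn K mu m k') z) *
     (\sum_c0 \sum_l vthird CA e L mu m ord0 i' c0 l z * z.2 c0 l) =
   \sum_l \sum_m Cvert K i' l m z * Rx1 K m j' k' z * z.2 ord0 l.
  (* The curvature term differentiates in the order m, i, l while [Cvert] has i, l, m; the total
     symmetry of the third vertical derivative reconciles them. *)
  rewrite [RHS]exchange_big; apply: eq_bigr => m _ /=.
  rewrite !big_ord1 mulr_sumr; apply: eq_bigr => l _.
  have -> : Cvert K i' l m z = vthird CA e L ord0 m ord0 i' ord0 l z.
    exact: (vthird_rotate e s_L ord0 i' ord0 l ord0 m Az).
  by rewrite mulrCA mulrA.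
exact: eq_cyclic.
Qed.

Lemma lowered_cartan_single i l m z : jet_dom c d z ->
  \sum_q Gvert K ord0 l ord0 q z * Ccart K q ord0 i m z = 2^-1 * Cvert K i l m z.
Proof.
move=> Az.
exact (lowered_cartan s_hi s_L s_g dv_hi h_hi g_s g_gi kron i l m Az).
Qed.

Lemma maxwell_vertical_single i j k z : jet_dom c d z ->
  cyclic (fun i j k => covv_tU_xDD K (Fem K) ord0 i j ord0 k z) i j k = 0.
Proof.
move=> Az.
apply: (local_maxwell_vertical (K := K) s_N s_L g_s (a := ord0) (c := ord0) i j k Az).
  move=> i' j' w Aw; exact (dv_vlow_sym_single s_y d_y s_L ord0 ord0 i' j' Aw).
move=> b m j' k'.
exact (spray_conn_sym (ut ord0) ux (s_y ord0) s_h s_hi (s_H _ _ _) s_L s_g s_gi dv_h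
  b m j' k' Az).
Qed.

End SingleTimeMaxwell.

Theorem theorem3p3 (R : realType) (n : nat) :
  (forall (T : manifold R 1) (M : manifold R n) (h : metric T)
      (S : ML_space M h) (c : chart R 1 T) (d : chart R n M),
    atlas c -> atlas d ->
    let K := canonical1 S c d in
    forall z : coords R 1 n, jet_dom c d z ->
    [/\ forall i k : 'I_n,
          covt_tU_xDD K (Fem K) ord0 i k ord0 z
          = maxwell_rhs K (Rt1 K) ord0 ord0 z i k,
        forall i j k : 'I_n,
          cyclic (fun i j k => covx_tU_xDD K (Fem K) ord0 i j k z) i j k
          = - 2^-1 * cyclic (fun i j k =>
              \sum_l \sum_m Cvert K i l m z * Rx1 K m j k z * z.2 ord0 l) i j k,
        forall i l m : 'I_n,
          \sum_q Gvert K ord0 l ord0 q z * Ccart K q ord0 i m z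
          = 2^-1 * Cvert K i l m z
      & forall i j k : 'I_n,
          cyclic (fun i j k => covv_tU_xDD K (Fem K) ord0 i j ord0 k z) i j k
          = 0])
  /\
  (forall (p : nat), (2 <= p)%N ->
   forall (T : manifold R p) (M : manifold R n) (h : metric T)
      (S : ML_space M h) (c : chart R p T) (d : chart R n M),
    atlas c -> atlas d ->
    let K := canonical_multi S c d in
    forall z : coords R p n, jet_dom c d z ->
    [/\ forall (a b : 'I_p) (i k : 'I_n),
          covt_tU_xDD K (Fem K) a i k b z
          = maxwell_rhs K (Rt_multi K) a b z i k,
        forall (a : 'I_p) (i j k : 'I_n),
          cyclic (fun i j k => covx_tU_xDD K (Fem K) a i j k z) i j k = 0
      & forall (a c' : 'I_p) (i j k : 'I_n),
          cyclic (fun i j k => covv_tU_xDD K (Fem K) a i j c' k z) i j k = 0]).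
Proof.
split=> [T M h S c d atlas_c atlas_d K z Az|p p_gt1 T M h S c d atlas_c atlas_d K z Az].
  split=> [i k|i j k|i l m|i j k].
  - exact (maxwell_time_single S atlas_c atlas_d i k Az).
  - exact (maxwell_space_single S atlas_c atlas_d i j k Az).
  - exact (lowered_cartan_single S atlas_c atlas_d i l m Az).
  - exact (maxwell_vertical_single S atlas_c atlas_d i j k Az).
split=> [a b i k|a i j k|a c' i j k].
- exact (maxwell_time_multi S p_gt1 atlas_c atlas_d a b i k Az).
- exact (maxwell_space_multi S p_gt1 atlas_c atlas_d a i j k Az).
- exact (maxwell_vertical_multi S p_gt1 atlas_c atlas_d a c' i j k Az).
Qed.
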